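(* Suppose that (H1), (H2), (H3) of the context hold, and additionally assume: (I1) for every sequence $\{v^k\}_k$ in $X$ such that there exist $\sigma^k \in \mathcal{M}_+(S)$ with $v^k \in \mathrm{dom}(R(\cdot,\sigma^k))$ for each $k$, and such that $v^k$ converges weakly* to some $v \in X$, it holds that $\lim_{k\to+\infty} Av^k = Av$ (in norm of $Y$). Let $$v^k = \sum_{i=1}^{N_k}c^k_iv^k_i \in X, \qquad \sigma^k = \sum_{s \in \{s^k_i :\, i=1,\dots,N_k\}} \bigg\|\sum_{j \in \{1,\dots,N_k :\, s^k_j=s\}}c^k_jv^k_j\bigg\|_X\delta_s$$ be the iterates generated by the Algorithm described in the context. If the Algorithm terminates after a finite number of iterations returning $(v^*,\sigma^* ) \in X \times \mathcal{M}_+(S)$, then $(v^*,\sigma^* )$ is a minimizer of $\mathcal{F}_\alpha(v,\sigma) = \frac12\|Av-f\|_Y^2 + \alpha R(v,\sigma)$ over $X\times\mathcal{M}_+(S)$. Moreover, there exists $C>0$ depending only on $f$ (the remaining problem data $X,Y,A,S,J,\alpha$ being fixed) such that $$\mathcal{F}_\alpha(v^k,\sigma^k) - \min_{\tilde v \in X,\ \tilde\sigma \in \mathcal{M}_+(S)}\mathcal{F}_\alpha(\tilde v,\tilde\sigma) \le \frac{C}{k+1}$$ for all $k \in \mathbb{N}$ (for which the iterate is defined).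
   Context: Setting: $X$ is a separable (real) Banach space that admits a predual $X_*$; $Y$ is a separable Hilbert space; $A : X \to Y$ is linear and weak*-to-weak continuous, i.e. the adjoint of some bounded linear operator $A_*: Y \to X_*$; $f \in Y$; $\alpha>0$; $S \subset \mathbb{R}^d$ ($d\in\mathbb{N}$) is non-empty and compact; $\mathcal{M}_+(S)$ is the set of finite positive Radon measures on $S$; $J : X \times S \to [0,+\infty]$ is a proper Borel-measurable functional. Hypotheses: (H1) for every $s \in S$, $J(\cdot,s)$ is proper, convex and positively one-homogeneous, i.e. $J(\lambda v,s) = \lambda J(v,s)$ for all $\lambda \ge 0$, $v \in X$ (with $0\cdot(+\infty)=0$); (H2) $J$ is sequentially lower semicontinuous on $X \times S$, where $X$ carries the weak* topology; (H3) there is a constant $C>0$ with $\|v\|_X \le C J(v,s)$ for all $v \in X$, $s \in S$. Infinite infimal convolution: $R(v,\sigma) = \inf\{\int_S J(u(s),s)\,d\sigma(s) : u \in L^1((S,\sigma);X),\ \int_S u\,d\sigma = v\}$ for $v \in X$, $\sigma \in \mathcal{M}_+(S)$ (Bochner space and integrals, $\inf\emptyset=+\infty$); $\mathrm{dom}(R(\cdot,\sigma)) = \{v : R(v,\sigma)<\infty\}$. For $s\in S$, $B^\alpha_s = \{v \in X : \alpha J(v,s)\le 1\}$ and $\mathrm{Ext}(B^\alpha_s)$ is its set of extreme points. Algorithm. Initialize $v^0=0$, $\sigma^0=0$, $\Xi^0=\emptyset$, $N_0=0$. For $k=0,1,2,\dots$, with $\Xi^k = \{(v^k_1,s^k_1),\dots,(v^k_{N_k},s^k_{N_k})\}$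 and associated positive weights $c^k_1,\dots,c^k_{N_k}$: 1. Set $p^k = -A_*(Av^k-f) \in X_*$. 2. Choose $(v^k_{N_k+1},s^k_{N_k+1}) \in \mathrm{arg\,max}\{\langle p^k,v\rangle : (v,s) \in X \times S,\ v \in \mathrm{Ext}(B^\alpha_s)\}$. 3. If $k\ge1$ and ($\langle p^k,v^k_{N_k+1}\rangle \le 1$ or $(v^k_{N_k+1},s^k_{N_k+1}) \in \Xi^k$), stop and return $(v^k,\sigma^k)$. 4. Choose $\hat c^k \in \mathrm{arg\,min}_{c \in [0,\infty)^{N_k+1}}\frac12\left\|\sum_{i=1}^{N_k+1}c_iAv^k_i-f\right\|_Y^2 + \alpha\sum_{i=1}^{N_k+1}c_iJ(v^k_i,s^k_i)$. 5. Set $v^{k+1} = \sum_{i=1}^{N_k+1}\hat c^k_iv^k_i$ and $\sigma^{k+1} = \sum_{s \in \{s^k_i:\,i=1,\dots,N_k+1\}}\left\|\sum_{j\in\{1,\dots,N_k+1:\, s^k_j=s\}}\hat c^k_jv^k_j\right\|_X\delta_s$. 6. Set $\Xi^{k+1} = \{(v^k_i,s^k_i) \in \Xi^k\cup\{(v^k_{N_k+1},s^k_{N_k+1})\} : \hat c^k_i>0\}$, $N_{k+1}=\#\Xi^{k+1}$ (relabelling the elements and their weights, which become $c^{k+1}_i$). Standing convention: no pair with $v^k_{N_k+1}=0$ is ever inserted at any iteration. *)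

(* Defs.v *)
From HB Require Import structures.
From mathcomp Require Import all_boot all_order all_algebra.
From mathcomp Require Import all_classical all_reals all_analysis.
From mathcomp Require Import measurable_realfun.

Set Implicit Arguments.
Unset Strict Implicit.
Unset Printing Implicit Defensive.

Import Order.TTheory GRing.Theory Num.Theory.
Import numFieldNormedType.Exports.

Local Open Scope classical_set_scope.
Local Open Scope ring_scope.

Notation borelType T := (g_sigma_algebraType (@open T)).

Definition separable (T : topologicalType) : Prop :=
  exists2 D : set T, countable D & dense D.

Definition minimizer (T : Type) (R : realType) (D : set T) (F : T -> \bar R)
    (x : T) : Prop :=
  D x /\ forall y, D y -> (F x <= F y)%E.

Definition extreme_points (R : realType) (V : lmodType R) (B : set V) :
    set V :=
  [set v | B v /\ forall (x y : V) (t : R), B x -> B y -> 0 < t < 1 ->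
     v = t *: x + (1 - t) *: y -> x = v /\ y = v].

Section functional_analysis.
Context {R : realType}.

(* [pr] exhibits [X] as the dual space of [Xs]: [v |-> pr ^~ v] is an isometry
   from [X] onto the continuous linear forms on [Xs]. *)
Definition is_predual (Xs X : normedModType R)
    (pr : {bilinear Xs -> X -> R | *%R & *%R}) : Prop :=
  (forall v : X, `|v|%:E = ereal_sup [set `|pr p v|%:E | p in [set p | `|p| <= 1]])
  /\ (forall phi : {linear Xs -> R | *%R}, continuous (phi : Xs -> R) ->
        exists v : X, forall p, phi p = pr p v).

Definition weakstar_cvg (Xs X : normedModType R) (pr : Xs -> X -> R)
    (u : nat -> X) (v : X) : Prop :=
  forall p : Xs, pr p (u n) @[n --> \oo] --> pr p v.

Definition induces_norm (Y : normedModType R) (ip : Y -> Y -> R) : Prop :=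
  forall y : Y, `|y| ^+ 2 = ip y y.

End functional_analysis.

Section bochner.
Context {R : realType} {d : measure_display} {T : measurableType d}.
Context {X : completeNormedModType R}.
Implicit Types (D : set T) (u g : T -> X).

Definition simple_function g : Prop :=
  measurable_fun setT (g : T -> borelType X) /\ finite_set (range g).

(* Only used for measures that are finite on [D], for which every simple
   function is integrable. *)
Definition simple_integral (mu : set T -> \bar R) D g : X :=
  \sum_(x \in range g) fine (mu (D `&` g @^-1` [set x])) *: x.

(* Pointwise (rather than almost everywhere) limits, so that [u] is Borel:
   every class of functions modulo null sets has such a representative. *)
Definition strongly_measurable D u : Prop :=
  exists g : nat -> T -> X, (forall n, simple_function (g n)) /\
    (forall x, D x -> g n x @[n --> \oo] --> u x).

Definition bochner_L1 (mu : {measure set T -> \bar R}) D : set (T -> X) :=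
  [set u | strongly_measurable D u /\
           (\int[mu]_(x in D) `|u x|%:E < +oo)%E].

Definition has_bochner_integral (mu : {measure set T -> \bar R}) D u (v : X) :
    Prop :=
  exists g : nat -> T -> X, [/\ (forall n, simple_function (g n)),
    (\int[mu]_(x in D) `|u x - g n x|%:E)%E @[n --> \oo] --> 0%E &
    simple_integral mu D (g n) @[n --> \oo] --> v].

End bochner.

Section infinite_infimal_convolution.
Context {R : realType} {d : nat} {X : completeNormedModType R}.

Notation E := ('rV[R]_d).
Notation measE := {measure set (borelType E) -> \bar R}.

(* A measure on [S] is a Borel measure on the ambient space that vanishes
   outside [S]. *)
Definition radon_plus (S : set E) : set measE :=
  [set sigma : measE | [/\ fin_num_fun sigma, sigma (~` S) = 0%E &
     forall B : set (borelType E), measurable B ->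
       sigma B = ereal_sup [set sigma K | K in
                              [set K : set E | compact K /\ K `<=` B]]]].

Variables (S : set E) (J : X -> E -> \bar R).

(* [J] is only ever evaluated at second arguments in [S]. *)
Definition infconv (v : X) (sigma : measE) : \bar R :=
  ereal_inf [set (\int[sigma]_(s in S) J (u s) s)%E | u in
    [set u : borelType E -> X |
       bochner_L1 sigma S u /\ has_bochner_integral sigma S u v]].

Definition dom_infconv (sigma : measE) : set X :=
  [set v | (infconv v sigma < +oo)%E].

Definition proper_borel : Prop :=
  [/\ (forall v s, S s -> (0 <= J v s)%E),
      (exists v s, S s /\ (J v s < +oo)%E) &
      measurable_fun ([set q | S q.2] : set (borelType (X * E)%type))
        (fun q : borelType (X * E)%type => J q.1 q.2)].

Definition hypothesis_H1 : Prop := forall s, S s ->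
  [/\ (exists v, (J v s < +oo)%E),
      (forall (x y : X) (t : R), 0 <= t <= 1 ->
        (J (t *: x + (1 - t) *: y)%R s <= t%:E * J x s + (1 - t)%:E * J y s)%E) &
      (forall (l : R) (v : X), 0 <= l -> J (l *: v) s = (l%:E * J v s)%E)].

Definition hypothesis_H2 (Xs : normedModType R) (pr : Xs -> X -> R) : Prop :=
  forall (u : nat -> X) (v : X) (t : nat -> E) (s : E),
    weakstar_cvg pr u v -> (forall n, S (t n)) -> S s ->
    t n @[n --> \oo] --> s ->
    (J v s <= limn_einf (fun n => J (u n) (t n)))%E.

Definition hypothesis_H3 : Prop :=
  exists2 C : R, 0 < C & forall v s, S s -> (`|v|%:E <= C%:E * J v s)%E.

Definition hypothesis_I1 (Xs : normedModType R) (pr : Xs -> X -> R)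
    (Y : normedModType R) (A : X -> Y) : Prop :=
  forall (u : nat -> X) (v : X),
    (forall k, exists2 sigma, radon_plus S sigma & dom_infconv sigma (u k)) ->
    weakstar_cvg pr u v -> A (u k) @[k --> \oo] --> A v.

Definition tikhonov (Y : normedModType R) (A : X -> Y) (f : Y) (alpha : R)
    (w : X * measE) : \bar R :=
  ((2^-1 * `|A w.1 - f| ^+ 2)%:E + alpha%:E * infconv w.1 w.2)%E.

End infinite_infimal_convolution.

Section algorithm.
Context {R : realType} {d : nat} {Xs X Y : completeNormedModType R}.

Notation E := ('rV[R]_d).
Notation measE := {measure set (borelType E) -> \bar R}.

Variables (pr : Xs -> X -> R) (A : X -> Y) (Astar : Y -> Xs) (S : set E)
  (J : X -> E -> \bar R) (alpha : R) (f : Y).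

(* The algorithm's state at iteration [k] is the list of the weighted atoms
   [((v_i, s_i), c_i)]; the iterates [v^k] and [sigma^k] are functions of it. *)
Notation state := (seq ((X * E) * R)).

Definition iterate_v (a : state) : X := \sum_(q <- a) q.2 *: q.1.1.

Definition iterate_sigma (a : state) : measE :=
  let supp := undup [seq q.1.2 | q <- a] in
  msum (fun i => let s := nth 0 supp i in
          mscale (`|\sum_(q <- a | q.1.2 == s) q.2 *: q.1.1|%:nng)
                 (@dirac _ (borelType E) s R))
       (size supp).

Definition dual_variable (a : state) : Xs :=
  - Astar (A (iterate_v a) - f).

Definition sublevel_ball (s : E) : set X :=
  [set v | (alpha%:E * J v s <= 1)%E].

Definition candidates : set (X * E) :=
  [set q | S q.2 /\ extreme_points (sublevel_ball q.2) q.1].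

Definition insertion (a : state) : set (X * E) :=
  [set q | candidates q /\ forall q', candidates q' ->
     pr (dual_variable a) q'.1 <= pr (dual_variable a) q.1].

Definition stopping_criterion (k : nat) (a : state) (q : X * E) : Prop :=
  (1 <= k)%N /\ (pr (dual_variable a) q.1 <= 1 \/ q \in unzip1 a).

Definition weight_objective (a : state) : \bar R :=
  ((2^-1 * `|\sum_(q <- a) q.2 *: A q.1.1 - f| ^+ 2)%:E +
   alpha%:E * \sum_(q <- a) q.2%:E * J q.1.1 q.1.2)%E.

(* Weight vectors in [0, oo)^n for the atoms [atoms] are encoded by the lists of
   weighted atoms that they form with [atoms]. *)
Definition weightings (atoms : seq (X * E)) : set state :=
  [set a | unzip1 a = atoms /\ forall q, q \in a -> 0 <= q.2].

(* [perm_eq] leaves the relabelling of the remaining atoms free. *)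
Definition step (k : nat) (a a' : state) : Prop :=
  exists2 q : X * E,
    [/\ insertion a q, ~ stopping_criterion k a q & q.1 <> 0] &
    exists2 b : state,
      minimizer (weightings (rcons (unzip1 a) q)) weight_objective b &
      perm_eq a' [seq w <- b | 0 < w.2].

(* [is_iterate k a]: some run of the algorithm is in state [a] at the start of
   iteration [k]. *)
Inductive is_iterate : nat -> state -> Prop :=
| is_iterate0 : is_iterate 0 [::]
| is_iterateS k a a' : is_iterate k a -> step k a a' -> is_iterate k.+1 a'.

Definition terminates_at (k : nat) (a : state) : Prop :=
  is_iterate k a /\ exists2 q, insertion a q & stopping_criterion k a q.

End algorithm.

(* Main.v *)
(* If [pr p <= m] on every atom, then [pr p v <= m * (alpha * R(v, sigma))]; through
   this bound the objective is compared with the measures only by duality, and the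
   rate analysis takes place among finite weighted families of atoms: by optimality
   of its weights, one iteration is at least as good as any conditional gradient step
   towards a multiple of the inserted atom, which yields the [C / (k + 1)] bound.

   A minimizer is built from an ultralimit of a minimizing sequence of finite
   combinations of atoms, which is a positive functional on bounded functions of
   [(v, s)]. It is represented by a curve of atoms over an interval; the
   [s]-component of the curve pushes Lebesgue measure forward to [sigma], the
   conditional expectations given [s] of countably many norming pairings are
   Radon-Nikodym densities, and by separation in finite dimensions and compactness
   they are the moments of an atom [u(s)] for almost every [s]. Measurability and
   the integral of [u] then follow from Pettis' argument. *)
Require Import Defs.
From HB Require Import structures.
From mathcomp Require Import all_boot all_order all_algebra.
From mathcomp Require Import all_classical all_reals all_analysis.
From mathcomp Require Import measurable_realfun.
From mathcomp Require Import ring lra.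

Set Implicit Arguments.
Unset Strict Implicit.
Unset Printing Implicit Defensive.

Import Order.TTheory GRing.Theory Num.Theory.
Import numFieldNormedType.Exports.

Local Open Scope classical_set_scope.
Local Open Scope ring_scope.

(** * Weak* compactness in a separable dual space *)

(** Three obstacles shape the proof. The algorithm maximizes over extreme points only, while every
    duality bound needs control of all atoms; a maximizer over the atoms that is itself extreme
    closes this gap. A weak* limit of combinations in [X] is not yet a minimizer, because its cost
    has to be carried by a single pair of a measure and a density. The ultrafilter is chosen here
    because it assigns a limit to every bounded function at once, indicators included, so that
    arbitrary cells of atoms have a mass. Finally, [J (u s) s] enters only through comparisons of
    integrals of nonnegative functions. In the rate, the total mass of a useful competitor is at
    most [misfit 0], the objective at the zero point. The linearized objective is affine in the mass
    put on the inserted atom, hence minimal at mass [0] or [misfit 0]; this fixes the multiple of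
    the atom to step towards and bounds all step lengths uniformly. *)

Lemma ultra_cluster_cvg (T : topologicalType) (I : Type) (U : set_system I)
    (h : I -> T) (l : T) :
  UltraFilter U -> cluster (h @ U) l -> h @ U --> l.
Proof.
move=> UU cl V Vl; have [//|UnV] := in_ultra_setVsetC (h @^-1` V) UU.
by have [y []] := cl (~` V) V UnV Vl.
Qed.

Lemma compact_ultra_cvg (T : topologicalType) (I : Type) (U : set_system I)
    (h : I -> T) (K : set T) :
  UltraFilter U -> compact K -> (forall i, K (h i)) ->
  exists2 l, K l & h @ U --> l.
Proof.
move=> UU cK Kh; have hK : U (h @^-1` K) by exact: (@filterE _ _ _ (h @^-1` K) Kh).
have [l [Kl cl]] := cK (h @ U) _ hK.
by exists l => //; exact: ultra_cluster_cvg.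
Qed.

Lemma bounded_ultra_cvg (R : realType) (I : Type) (U : set_system I)
    (u : I -> R) (M : R) :
  UltraFilter U -> (forall i, `|u i| <= M) ->
  exists2 l, `|l| <= M & u @ U --> l.
Proof.
move=> UU uM.
have [|l lM ul] := @compact_ultra_cvg _ _ U u `[- M, M]%classic UU
  (@segment_compact _ _ _).
  by move=> i /=; rewrite in_itv/= -ler_norml.
by exists l => //; move: lM; rewrite /= in_itv/= -ler_norml.
Qed.

(** If [h] misses a neighbourhood [V] of [l] frequently along [F], then the trace of [F] on that
    event is proper and extends to an ultrafilter along which [h] cannot tend to [l]. *)
Lemma cvg_ultra_subset (T : topologicalType) (I : Type) (F : set_system I)
    (h : I -> T) (l : T) : ProperFilter F ->
  (forall U, UltraFilter U -> F `<=` U -> h @ U --> l) -> h @ F --> l.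
Proof.
move=> PF hU V Vl; apply: contrapT => nFV.
have PG : ProperFilter (within (~` (h @^-1` V)) F).
  apply: Build_ProperFilter_ex => A FA; apply: contrapT => nA.
  have FV : F (h @^-1` V).
    move: FA; rewrite /within/=; apply: filterS => i Ai; apply: contrapT => nVi.
    by apply: nA; exists i; exact: Ai.
  exact: nFV FV.
have [U [UU FU]] := ultraFilterLemma PG.
have UV : U (h @^-1` V).
  by apply: (hU U UU) => // A FA; apply: FU; apply: filterS FA => i Ai _.
have UnV : U (~` (h @^-1` V)) by apply: FU; rewrite /within/=; exact: filterE.
by have /filter_ex[i []] : U (h @^-1` V `&` ~` (h @^-1` V)) by exact: filterI.
Qed.

Section predual.
Context {R : realType} {Xs X : completeNormedModType R}.
Context (pr : {bilinear Xs -> X -> R | *%R & *%R}).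
Hypothesis hpr : is_predual pr.

Lemma pairing_le (p : Xs) (v : X) : `|pr p v| <= `|p| * `|v|.
Proof.
have key q : `|q| <= 1 -> `|pr q v| <= `|v|.
  move=> q1; rewrite -lee_fin (hpr.1 v); apply: ereal_sup_ubound.
  by exists q.
have [->|p0] := eqVneq p 0; first by rewrite linear0l !normr0 mul0r.
have np : 0 < `|p| by rewrite normr_gt0.
have /key : `|(`|p|^-1 *: p)| <= 1.
  by rewrite normrZ normrV ?unitfE ?gt_eqF// normr_id mulVf// gt_eqF.
rewrite linearZl_LR normrM normrV ?unitfE ?gt_eqF// normr_id.
by rewrite ler_pdivrMl.
Qed.

Lemma pairing_norming (v : X) (e : R) : 0 < e ->
  exists2 p : Xs, `|p| <= 1 & `|v| - e < pr p v.
Proof.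
move=> e0; have : ((`|v| - e)%:E < `|v|%:E)%E.
  by rewrite lte_fin ltrBlDr ltrDl.
rewrite [X in (_ < X)%E](hpr.1 v) => /ereal_sup_gt[_ [p p1 <-]]; rewrite lte_fin => vp.
have [pv|pv] := leP 0 (pr p v); first by exists p => //; rewrite -(ger0_norm pv).
by exists (- p); rewrite ?normrN// linearNl/= -(ltr0_norm pv).
Qed.

(** Countably many forms that recover the norm: they separate points and suffice to test
    measurability and bounded weak* convergence. *)
Definition norming_seq (P : nat -> Xs) := (forall i, `|P i| <= 1) /\
  forall (v : X) (e : R), 0 < e -> exists i, `|v| - e < pr (P i) v.

(** Almost norming forms are chosen at the points of a dense sequence, one for each precision.
    Moving from a dense point to [v] costs [e / 4] twice, the precision a third [e / 4]. *)
Lemma norming_seq_exists : separable X -> exists P, norming_seq P.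
Proof.
move=> [D /countable_injP[f] finj dD].
pose x n := xget 0 [set x | D x /\ f x = n].
have Dx y : D y -> exists n, x n = y.
  move=> Dy; exists (f y); rewrite /x; case: xgetP => [z zE [Dz fz]|/(_ y)].
    by apply: finj; rewrite ?inE.
  by case.
have /choice[g gP] (m : nat * nat) :
    exists p : Xs, `|p| <= 1 /\ `|x m.1| - m.2.+1%:R^-1 < pr p (x m.1).
  by have [p p1 xp] := @pairing_norming (x m.1) m.2.+1%:R^-1 ltac:(done);
    exists p.
(* Integers that encode no pair are sent to the zero form, which stays in the unit ball. *)
exists (fun n => odflt 0 (omap g (unpickle n))); split.
  move=> n; case: (unpickle n) => [m|] /=; last by rewrite normr0.
  by have [] := gP m.
move=> v e e0; have e4 : 0 < e / 4 by rewrite divr_gt0.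
have [y [vy Dy]] := dD (ball v (e / 4)) (ex_intro _ v (ballxx v e4)) (ball_open v (e / 4)).
have [n xn] := Dx _ Dy; have [k ke] : exists k, k.+1%:R^-1 < e / 4.
  by have [k _ /(_ k (leqnn _))] := near_infty_natSinv_lt (PosNum e4); exists k.
exists (pickle (n, k)); rewrite pickleK/=.
have [p1 /=] := gP (n, k); rewrite /= xn; set p := g _ in p1 * => yp.
have vye : `|v - y| < e / 4 by move: vy; rewrite -ball_normE.
have : `|pr p (v - y)| <= e / 4.
  apply: (le_trans (pairing_le _ _)); rewrite -[leRHS]mul1r.
  by apply: ler_pM => //; exact: ltW.
rewrite linearBr ler_norml => /andP[pvy _].
have : `|v| <= `|y| + `|v - y| by rewrite -{1}(subrK y v) addrC ler_normD.
move: (k.+1%:R^-1) (`|v - y|) ke yp vye pvy => z w; lra.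
Qed.

Context (P : nat -> Xs) (hP : norming_seq P).

Lemma norm_le_norming (v : X) (C : R) : (forall i, pr (P i) v <= C) -> `|v| <= C.
Proof.
move=> vC; apply/ler_addgt0Pr => e e0; have [i vi] := hP.2 v e e0.
by rewrite -lerBlDr (le_trans (ltW vi)).
Qed.

Lemma eq_norming (v w : X) : (forall i, pr (P i) v = pr (P i) w) -> v = w.
Proof.
move=> vw; apply/eqP; rewrite -subr_eq0 -normr_le0.
by apply: norm_le_norming => i; rewrite linearBr/= vw subrr.
Qed.

(** The ultralimits of the pairings form a bounded linear form in [p], and the predual property
    represents it by a point of [X]. *)
Lemma banach_alaoglu_ultra (I : Type) (U : set_system I) (x : I -> X) (M : R) :
  UltraFilter U -> (forall n, `|x n| <= M) ->
  exists a, forall p, pr p (x n) @[n --> U] --> pr p a.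
Proof.
move=> UU xM.
have /choice[l lP] (p : Xs) : exists l : R, `|l| <= `|p| * M /\ pr p (x n) @[n --> U] --> l.
  have [|l lM xl] := @bounded_ultra_cvg _ _ U (fun n => pr p (x n)) (`|p| * M) UU.
    by move=> n; apply: (le_trans (pairing_le _ _)); rewrite ler_wpM2l.
  by exists l.
have llin : GRing.linear_for ( *%R : R -> R -> R) (l : Xs -> R).
  move=> c p q; have h : pr (c *: p + q) (x n) @[n --> U] --> c * l p + l q.
    rewrite [X in X @ U](_ : _ = (fun n => c * pr p (x n) + pr q (x n))); last first.
      by apply/funext => n; rewrite linearPl.
    by apply: cvgD; [apply: cvgMl_tmp|]; exact: (lP _).2.
  exact: (cvg_unique _ (lP (c *: p + q)).2 h).
pose L := GRing.isLinear.Build R Xs R *%R l llin.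
pose phi : {linear Xs -> R | *%R} := HB.pack l L.
have [|a aP] := hpr.2 phi.
  move=> p; apply/cvgrPdist_lt => e e0.
  have M0 : 0 < `|M| + 1 by rewrite ltr_wpDl.
  have eM : 0 < e / (`|M| + 1) by rewrite divr_gt0.
  near=> q; have -> : phi p - phi q = phi (p - q) by rewrite linearB.
  apply: (le_lt_trans (lP (p - q)).1).
  have pq : `|p - q| < e / (`|M| + 1).
    by near: q; apply: cvgr_dist_lt => //; exact: cvg_id.
  apply: (@le_lt_trans _ _ (`|p - q| * (`|M| + 1))).
    by rewrite ler_wpM2l// (le_trans (ler_norm _))// lerDl.
  by rewrite -ltr_pdivlMr.
by exists a => p; rewrite -aP; exact: (lP p).2.
Unshelve. all: by end_near. Qed.

(** Along every finer ultrafilter some weak* limit exists by boundedness, and the norming sequence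
    identifies it as [a]. *)
Lemma weakstar_cvg_ultra (x : nat -> X) (a : X) (M : R) :
  (forall n, `|x n| <= M) ->
  (forall i, pr (P i) (x n) @[n --> \oo] --> pr (P i) a) ->
  weakstar_cvg pr x a.
Proof.
move=> xM xa p; apply: cvg_ultra_subset => U UU ooU.
have [b xb] := @banach_alaoglu_ultra _ U x M UU xM.
suff -> : a = b by exact: xb.
apply: eq_norming => i; apply: (cvg_unique _ _ (xb (P i))) => //.
by apply: cvg_trans (xa i); exact: cvg_app ooU.
Qed.

(** The limits are taken along a free ultrafilter; then [h k] is an index at which the first [k + 1]
    pairings and the point of [S] are within [1 / (k + 1)] of them. The map [h] need not be
    increasing: [k <= h k] is all that is used later. *)
Lemma weakstar_seq_compact (d : nat) (S : set 'rV[R]_d) (x : nat -> X)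
    (t : nat -> 'rV[R]_d) (M : R) :
  compact S -> (forall n, `|x n| <= M) -> (forall n, S (t n)) ->
  exists (h : nat -> nat) (a : X) (s : 'rV[R]_d),
    [/\ forall k, (k <= h k)%N, weakstar_cvg pr (x \o h) a, S s &
       t (h k) @[k --> \oo] --> s].
Proof.
move=> cS xM St; have [U [UU ooU]] := ultraFilterLemma (eventually_filter).
have [a xa] := @banach_alaoglu_ultra _ U x M UU xM.
have [s Ss ts] := @compact_ultra_cvg _ _ U t S UU cS St.
have /choice[h hh] (k : nat) : exists n, [/\ (k <= n)%N,
    forall i, (i <= k)%N -> `|pr (P i) a - pr (P i) (x n)| < k.+1%:R^-1 &
    ball s k.+1%:R^-1 (t n)].
  have k0 : 0 < k.+1%:R^-1 :> R by rewrite invr_gt0.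
  suff : U [set n | [/\ (k <= n)%N,
    forall i, (i <= k)%N -> `|pr (P i) a - pr (P i) (x n)| < k.+1%:R^-1 &
    ball s k.+1%:R^-1 (t n)]] by move=> /filter_ex.
  have U1 : U [set n | (k <= n)%N] by apply: ooU; exact: nbhs_infty_ge.
  have U2 : U [set n | ball s k.+1%:R^-1 (t n)].
    by apply: ts; exact: nbhsx_ballx.
  have U3 : U [set n | forall i : 'I_k.+1,
      `|pr (P i) a - pr (P i) (x n)| < k.+1%:R^-1].
    apply: filter_forall => i.
    by have /cvgrPdist_lt/(_ _ k0) := xa (P i).
  apply: filterS3 U1 U2 U3 => n kn sn xn; split => // i ik.
  by have := xn (Ordinal (ik : (i < k.+1)%N)).
exists h, a, s; split => //.
- by move=> k; have [] := hh k.
- apply: (@weakstar_cvg_ultra _ _ M) => [n /=|i]; first exact: xM.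
  apply/cvgrPdist_lt => e e0; near=> k.
  have [_ /(_ i) + _] := hh k; move=> /(_ _)/lt_trans; apply.
    by near: k; exact: nbhs_infty_ge.
  by near: k; exact: (near_infty_natSinv_lt (PosNum e0)).
- apply/cvg_ballP => e e0; near=> k.
  have [_ _] := hh k; apply: le_ball; apply: ltW.
  by near: k; exact: (near_infty_natSinv_lt (PosNum e0)).
Unshelve. all: by end_near. Qed.

End predual.

(** * Bochner integrals paired with the predual *)

Lemma cvge0_lt (R : realType) (u : nat -> \bar R) (e : R) :
  u n @[n --> \oo] --> 0%E -> 0 < e -> \forall n \near \oo, (u n < e%:E)%E.
Proof.
move=> u0 e0; have : nbhs (0%E : \bar R) [set x | (x < e%:E)%E].
  apply: open_nbhs_nbhs; split; first exact: open_ereal_lt_ereal.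
  by rewrite /= lte_fin.
exact: u0.
Qed.

(** The integral of a nonnegative function is a supremum over the simple functions below it, so the
    comparison holds for arbitrary functions, in particular for [J (u s) s]. *)
Lemma ge0_le_lower_integral (d : measure_display) (T : measurableType d)
    (R : realType) (mu : {measure set T -> \bar R}) (D : set T)
    (f g : T -> \bar R) :
  (forall x, D x -> 0 <= f x)%E -> (forall x, D x -> f x <= g x)%E ->
  (\int[mu]_(x in D) f x <= \int[mu]_(x in D) g x)%E.
Proof.
move=> f0 fg; have g0 x : D x -> (0 <= g x)%E.
  by move=> Dx; exact: le_trans (f0 _ Dx) (fg _ Dx).
rewrite !ge0_integralE//; apply: le_ereal_sup => _ [h hf <-].
exists h => // x; apply: (le_trans (hf x)).
by rewrite /patch; case: ifPn => // /set_mem; exact: fg.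
Qed.

Lemma open_borel (T : ptopologicalType) (U : set T) :
  open U -> measurable (U : set (borelType T)).
Proof. by move=> oU; exact: sub_sigma_algebra. Qed.

Lemma closed_borel (T : ptopologicalType) (F : set T) :
  closed F -> measurable (F : set (borelType T)).
Proof.
move=> cF; rewrite -[F]setCK; apply: measurableC.
by apply: open_borel; exact: closed_openC.
Qed.

Section bochner_pairing.
Context {R : realType} {dT : measure_display} {T : measurableType dT}.
Context {Xs X : completeNormedModType R}.
Context (pr : {bilinear Xs -> X -> R | *%R & *%R}) (hpr : is_predual pr).
Implicit Types (g u : T -> X) (D : set T) (mu : {measure set T -> \bar R}).

Lemma simple_function_preimage g (B : set X) :
  simple_function g -> measurable (g @^-1` B).
Proof.
move=> [mg fg]; rewrite (_ : _ @^-1` _ = \bigcup_(y in range g `&` B) g @^-1` [set y]).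
  apply: fin_bigcup_measurable; first exact: finite_setIl.
  move=> y _; rewrite -[X in measurable X]setTI; apply: mg => //.
  apply: closed_borel; apply: accessible_closed_set1.
  exact/hausdorff_accessible/norm_hausdorff.
apply/seteqP; split => [x Bx|x [y [_ By]] /= gxy]; last by rewrite gxy.
by exists (g x) => //; split => //; exists x.
Qed.

Lemma simple_function_comp g (h : X -> R) :
  simple_function g -> measurable_fun setT (h \o g).
Proof.
move=> sg _ B _; rewrite setTI comp_preimage.
exact: simple_function_preimage.
Qed.

Lemma simple_integrable mu D g (h : X -> R) : measurable D ->
  (mu D < +oo)%E -> simple_function g -> mu.-integrable D (EFin \o (h \o g)).
Proof.
move=> mD muD sg; apply: measurable_bounded_integrable => //.
  by apply: measurable_funTS; exact: simple_function_comp.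
have /finite_seqP[r rE] : finite_set (h @` range g).
  exact: finite_image sg.2.
exists (\sum_(y <- r) `|y|); split; first exact: num_real.
move=> y My x Dx /=; rewrite (le_trans _ (ltW My))//.
have xr : h (g x) \in r.
  have : (h @` range g) (h (g x)) by exists (g x) => //; exists x.
  by rewrite rE.
by rewrite (big_rem _ xr)/= lerDl sumr_ge0.
Qed.

Lemma pairing_simple_integral mu D g p : measurable D -> (mu D < +oo)%E ->
  simple_function g ->
  (\int[mu]_(x in D) (pr p (g x))%:E = (pr p (simple_integral mu D g))%:E)%E.
Proof.
move=> mD muD sg; have mpre y : measurable (g @^-1` [set y]).
  exact: simple_function_preimage.
have muDI y : mu (D `&` g @^-1` [set y]) \is a fin_num.
  rewrite ge0_fin_numE//; apply: le_lt_trans muD.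
  by apply: le_measure; rewrite ?inE//; exact: measurableI.
rewrite /simple_integral (fsbig_finite _ _ sg.2) linear_sum/=.
transitivity (\int[mu]_(x in D) \sum_(y <- finmap.enum_fset (fset_set (range g)))
    (pr p y * \1_(g @^-1` [set y]) x)%:E)%E.
  apply: eq_integral => x _; rewrite sumEFin; congr EFin.
  rewrite (bigD1_seq (g x))/=; last 2 first.
    by rewrite in_fset_set ?inE; [exists x|exact: sg.2].
    exact: finmap.fset_uniq.
  rewrite indicE mem_set// mulr1 big1 ?addr0// => y yx.
  by rewrite indicE memNset ?mulr0//= => gxy; rewrite gxy eqxx in yx.
rewrite integral_sum//; last first.
  move=> y; apply: (eq_integrable _ (EFin \o ((fun z => pr p y * (z == y)%:R) \o g))) => //.
    move=> x _ /=; rewrite indicE; congr (_ * _%:R)%:E.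
    by congr nat_of_bool; apply/eqP/idP => [gy|/set_mem//]; rewrite inE.
  exact: simple_integrable.
rewrite -sumEFin; apply: eq_bigr => y _.
under eq_integral do rewrite EFinM.
rewrite integralZl//; last first.
  apply: (eq_integrable _ (EFin \o ((fun z => (z == y)%:R) \o g))) => //.
    move=> x _ /=; rewrite indicE; congr (_%:R)%:E.
    by congr nat_of_bool; apply/eqP/idP => [gy|/set_mem//]; rewrite inE.
  exact: simple_integrable.
by rewrite integral_indic// linearZr_LR/= mulrC EFinM fineK// setIC.
Qed.

Lemma strongly_measurable_pairing D u p : strongly_measurable D u ->
  measurable_fun D (fun x => pr p (u x)).
Proof.
move=> [g [sg gu]]; apply: (@measurable_fun_cvg _ _ _ _ (fun n => pr p \o g n)).
  by move=> n; apply: measurable_funTS; exact: simple_function_comp.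
move=> x Dx; apply/cvgrPdist_lt => e e0.
have p0 : 0 < `|p| + 1 by rewrite ltr_wpDl.
have ep : 0 < e / (`|p| + 1) by rewrite divr_gt0.
near=> n; rewrite -linearBr/= (le_lt_trans (pairing_le hpr _ _))//.
apply: (@le_lt_trans _ _ ((`|p| + 1) * `|u x - g n x|)).
  by rewrite ler_wpM2r// lerDl.
rewrite -ltr_pdivlMl// mulrC; near: n.
by have /cvgrPdist_lt := gu _ Dx; apply.
Unshelve. all: by end_near. Qed.

Lemma bochner_pairing_integrable mu D u p : measurable D ->
  bochner_L1 mu D u -> mu.-integrable D (fun x => (pr p (u x))%:E).
Proof.
move=> mD [su uoo]; have mpu q := strongly_measurable_pairing q su.
(* For forms of norm at most 1 the pairing is dominated by [|u x|] itself, so no constant has to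
   leave the integral of the norm. The general case is rescaled by [|p| + 1], which is positive even
   for [p = 0]. *)
have key q : `|q| <= 1 -> mu.-integrable D (fun x => (pr q (u x))%:E).
  move=> q1; apply/integrableP; split; first exact/measurable_EFinP.
  apply: le_lt_trans uoo; apply: ge0_le_lower_integral => // x Dx.
  rewrite lee_fin (le_trans (pairing_le hpr _ _))//.
  by rewrite -[leRHS]mul1r ler_wpM2r.
have p0 : 0 < `|p| + 1 by rewrite ltr_wpDl.
apply: (eq_integrable mD (fun x => (`|p| + 1)%:E * (pr ((`|p| + 1)^-1 *: p) (u x))%:E)%E).
  move=> x _; by rewrite -EFinM linearZl_LR/= mulrA divff ?mul1r// gt_eqF.
apply: integrableZl => //; apply: key.
by rewrite normrZ gtr0_norm ?invr_gt0// ler_pdivrMl// mulr1 lerDl.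
Qed.

Lemma pairing_bochner_integral mu D u v p : measurable D -> (mu D < +oo)%E ->
  bochner_L1 mu D u -> has_bochner_integral mu D u v ->
  (\int[mu]_(x in D) (pr p (u x))%:E = (pr p v)%:E)%E.
Proof.
move=> mD muD uL [g [sg ug gv]].
have key q : `|q| <= 1 -> (\int[mu]_(x in D) (pr q (u x))%:E = (pr q v)%:E)%E.
  move=> q1; have iu := bochner_pairing_integrable q mD uL.
  have fu := integrable_fin_num mD iu.
  rewrite -(fineK fu); congr EFin; set I := fine _.
  have gI : pr q (simple_integral mu D (g n)) @[n --> \oo] --> I.
    apply/cvgrPdist_lt => e e0; near=> n.
    rewrite -lte_fin; apply: (@le_lt_trans _ _ (\int[mu]_(x in D) `|u x - g n x|%:E)%E).
      have ign : mu.-integrable D (fun x => (pr q (g n x))%:E).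
        exact: (simple_integrable (pr q) mD muD (sg n)).
      rewrite -abse_EFin EFinB {1}/I fineK// -(pairing_simple_integral q mD muD (sg n)).
      rewrite -integralB_EFin//.
      apply: (le_trans (le_abse_integral _ _ _)) => //.
        by apply: emeasurable_funB; [exact: measurable_int iu|exact: measurable_int ign].
      apply: ge0_le_lower_integral => // x Dx.
      rewrite -EFinB -linearBr lee_fin (le_trans (pairing_le hpr _ _))//.
      by rewrite -[leRHS]mul1r ler_wpM2r.
    near: n.
    exact: cvge0_lt ug e0.
  have gv' : pr q (simple_integral mu D (g n)) @[n --> \oo] --> pr q v.
    apply/cvgrPdist_lt => e e0; near=> n.
    rewrite -linearBr/= (le_lt_trans (pairing_le hpr _ _))//.
    apply: (@le_lt_trans _ _ `|v - simple_integral mu D (g n)|).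
      by rewrite -[leRHS]mul1r ler_wpM2r.
    by near: n; have /cvgrPdist_lt := gv; apply.
  exact: (cvg_unique _ gI gv').
have p0 : 0 < `|p| + 1 by rewrite ltr_wpDl.
have key' := key ((`|p| + 1)^-1 *: p).
transitivity (\int[mu]_(x in D) ((`|p| + 1)%:E * (pr ((`|p| + 1)^-1 *: p) (u x))%:E))%E.
  apply: eq_integral => x _; by rewrite -EFinM linearZl_LR/= mulrA divff ?mul1r// gt_eqF.
rewrite integralZl ?key'//; last exact: bochner_pairing_integrable.
  by rewrite -EFinM linearZl_LR/= mulrA divff ?mul1r// gt_eqF.
by rewrite normrZ gtr0_norm ?invr_gt0// ler_pdivrMl// mulr1 lerDl.
Unshelve. all: by end_near. Qed.

End bochner_pairing.

(** * Weak duality for the infimal convolution *)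

Section infconv_bounds.
Context {R : realType} {d : nat} {Xs X : completeNormedModType R}.
Context (pr : {bilinear Xs -> X -> R | *%R & *%R}) (hpr : is_predual pr).
Context (S : set 'rV[R]_d) (hS : compact S) (J : X -> 'rV[R]_d -> \bar R).

Local Notation E := 'rV[R]_d.
Local Notation measE := {measure set (borelType E) -> \bar R}.

Lemma compact_borel : measurable (S : set (borelType E)).
Proof. by apply: closed_borel; apply: compact_closed => //; exact: norm_hausdorff. Qed.

Lemma infconv_ge (p : Xs) (v : X) (sigma : measE) :
  (sigma S < +oo)%E ->
  (forall v s, S s -> 0 <= J v s)%E ->
  (forall x s, S s -> (pr p x)%:E <= J x s)%E ->
  ((pr p v)%:E <= infconv S J v sigma)%E.
Proof.
move=> Soo J0 pJ; apply: le_ereal_inf_tmp => _ [u [uL uv] <-].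
have mS := compact_borel.
rewrite -(pairing_bochner_integral hpr p mS Soo uL uv).
have iu := bochner_pairing_integrable hpr p mS uL.
(* The positive part separates two comparisons: integrable functions on the left, nonnegative but
   possibly non-measurable ones on the right. *)
apply: (@le_trans _ _ (\int[sigma]_(s in S) (fun s => (pr p (u s))%:E)^\+ s)%E).
  apply: le_integral => //; first exact: integrable_funepos.
  by move=> s _; rewrite funeposE le_max lexx.
apply: ge0_le_lower_integral => s Ss; first exact: funepos_ge0.
by rewrite funeposE ge_max pJ//= J0.
Qed.

Lemma infconv_ge0 (v : X) (sigma : measE) :
  (forall v s, S s -> 0 <= J v s)%E -> (0 <= infconv S J v sigma)%E.
Proof.
move=> J0; apply: le_ereal_inf_tmp => _ [u _ <-].
by apply: integral_ge0 => s Ss; exact: J0.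
Qed.

End infconv_bounds.

(** * Regularity of finite Borel measures *)

Section borel_regularity.
Context {R : realType} {V : normedModType R}.
Context (mu : {measure set (borelType V) -> \bar R}).
Hypothesis muT : (mu setT < +oo)%E.

Let mu_fin (B : set (borelType V)) : measurable B -> (mu B < +oo)%E.
Proof. by move=> mB; apply: le_lt_trans muT; apply: le_measure; rewrite ?inE. Qed.

Let regular (B : set V) := forall e : R, 0 < e -> exists F U : set V,
  [/\ closed F, open U, F `<=` B, B `<=` U &
      (mu ((U `\` F) : set (borelType V)) < e%:E)%E].

Let regular_setC B : regular B -> regular (~` B).
Proof.
move=> rB e e0; have [F [U [cF oU FB BU UF]]] := rB e e0.
exists (~` U), (~` F); split.
- exact: open_closedC.
- exact: closed_openC.
- exact: subsetC.
- exact: subsetC.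
- by rewrite setDE setCK setIC -setDE.
Qed.

Let decreasing_small (D : nat -> set (borelType V)) (e : R) : 0 < e ->
  (forall n, measurable (D n)) -> (forall n, D n.+1 `<=` D n) ->
  \bigcap_n D n = set0 -> exists n, (mu (D n) < e%:E)%E.
Proof.
move=> e0 mD Dle D0.
have Dhomo : {homo D : n m / (n <= m)%N >-> (m <= n)%O}.
  move=> n m /subnK <-; elim: (m - n)%N => [|k IH]; first by rewrite add0n.
  by apply: le_trans IH; rewrite addSn subsetEset; exact: Dle.
have := @nonincreasing_cvg_mu _ _ _ mu D (mu_fin (mD 0%N)) mD.
rewrite D0 measure0 => /(_ measurable0 Dhomo) D_0.
by have [n _ /(_ n (leqnn _))] := cvge0_lt D_0 e0; exists n.
Qed.

(** [U] is exhausted by the closed sets of points at distance at least [1 / (n + 1)] from its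
    complement. *)
Let regular_open (U : set V) : open U -> regular U.
Proof.
move=> oU e e0; pose F (n : nat) := \bigcap_(y in ~` U) [set x | n.+1%:R^-1 <= `|x - y|].
have cF n : closed (F n).
  apply: closed_bigI => y _.
  rewrite (_ : [set x | _] = (fun x => `|x - y|) @^-1` [set r | n.+1%:R^-1 <= r])//.
  apply: preimage_closed; last exact: closed_ge.
  by move=> x _; apply: cvg_norm; apply: cvgB; [exact: cvg_id|exact: cvg_cst].
have FU n : F n `<=` U.
  move=> x Fx; apply: contrapT => nUx; have := Fx x nUx.
  by rewrite /= subrr normr0 leNgt invr_gt0 ltr0n.
have [|n x [Ux nFx]||n Fn] := @decreasing_small (fun n => U `\` F n) e e0.
- by move=> n; apply: measurableD; [exact: open_borel|exact: closed_borel].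
- split => // Fx; apply: nFx => y nUy /=; apply: le_trans (Fx y nUy).
  by rewrite lef_pV2 ?posrE// ler_nat.
- apply/seteqP; split => // x Dx.
  have [Ux _] := Dx 0%N Logic.I.
  have := oU; rewrite openE => /(_ x Ux) /nbhs_ballP[r /= r0 rU].
  have [k _ /(_ k (leqnn _)) kr] := near_infty_natSinv_lt (PosNum r0).
  have [_] := Dx k Logic.I; apply => y nUy /=; rewrite leNgt; apply/negP => xy.
  by apply: nUy; apply: rU; rewrite -ball_normE/=; exact: lt_trans xy kr.
- by exists (F n), U; split.
Qed.

(** The errors of the pieces sum to at most [e / 2]. A countable union of closed sets need not be
    closed, so it is cut off after finitely many terms, at the price of the other [e / 2]. *)
Let regular_bigcup (B : nat -> set V) :
  (forall n, regular (B n)) -> regular (\bigcup_n B n).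
Proof.
move=> rB e e0; have e2 : 0 < e / 2 by rewrite divr_gt0.
have /choice[F /choice[U FU]] n : exists F U : set V,
  [/\ closed F, open U, F `<=` B n, B n `<=` U &
    (mu ((U `\` F) : set (borelType V)) < (e / 2 / (2 ^ n.+1)%:R)%:E)%E].
  by apply: rB; rewrite divr_gt0// ltr0n expn_gt0.
have mF n : measurable (F n : set (borelType V)).
  by apply: closed_borel; have [] := FU n.
have mU n : measurable (U n : set (borelType V)).
  by apply: open_borel; have [] := FU n.
pose G n := \bigcup_(k < n) F k.
have mG n : measurable (G n : set (borelType V)).
  by apply: bigcup_measurable => k _; exact: mF.
have mF' : measurable (\bigcup_n F n : set (borelType V)).
  exact: bigcup_measurable.
have [|n x [Fx nGx]||N muN] := @decreasing_small (fun n => \bigcup_n F n `\` G n) _ e2.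
- by move=> n; exact: measurableD.
- by split => // -[k kn Fk]; apply: nGx; exists k => //=; rewrite (ltn_trans kn).
- apply/seteqP; split => // x Dx; have [[k _ Fkx] _] := Dx 0%N Logic.I.
  by have [_] := Dx k.+1 Logic.I; apply; exists k => /=.
exists (G N), (\bigcup_n U n); split.
- rewrite /G bigcup_mkord; apply: closed_bigsetU => k _.
  by have [] := FU k.
- by apply: bigcup_open => n _; have [] := FU n.
- by move=> x [k _ Fx]; exists k => //; have [_ _ + _ _] := FU k; exact.
- by move=> x [k _ Fx]; exists k => //; have [_ _ _ + _] := FU k; exact.
have mUF : measurable (\bigcup_n (U n `\` F n) : set (borelType V)).
  by apply: bigcup_measurable => n _; exact: measurableD.
apply: (@le_lt_trans _ _ (mu (\bigcup_n (U n `\` F n) `|` (\bigcup_n F n `\` G N)))).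
  apply: le_measure; rewrite ?inE.
  - apply: measurableD => //; exact: bigcup_measurable.
  - by apply: measurableU => //; exact: measurableD.
  - move=> x [[k _ Ux] nG]; have [Fx|nFx] := pselect ((\bigcup_n F n) x); first by right.
    by left; exists k => //; split => // Fkx; apply: nFx; exists k.
have mD : measurable (\bigcup_n F n `\` G N : set (borelType V)) by exact: measurableD.
apply: (le_lt_trans (measureU2 _ mUF mD)).
rewrite (splitr e) EFinD; apply: lee_ltD => //.
  by rewrite ge0_fin_numE// mu_fin.
have mUFn n : measurable (U n `\` F n : set (borelType V)) by exact: measurableD.
apply: (le_trans (@measure_sigma_subadditive _ _ _ mu _ (fun n => U n `\` F n) mUFn mUF (@subset_refl _ _))).
apply: (le_trans _ (epsilon_trick0 xpredT (ltW e2))).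
by apply: lee_nneseries => n _ //; have [_ _ _ _ /ltW] := FU n.
Qed.

Lemma borel_regular (B : set (borelType V)) : measurable B ->
  forall e : R, 0 < e -> exists F U : set V,
  [/\ closed F, open U, F `<=` B, B `<=` U &
      (mu ((U `\` F) : set (borelType V)) < e%:E)%E].
Proof.
apply: (@smallest_sub _ _ _ [set B | regular B]) => [|U oU]; last exact: regular_open.
split => /=.
- exact/regular_open/open0.
- by move=> C /regular_setC; rewrite setTD.
- exact: regular_bigcup.
Qed.

End borel_regularity.

(** Inner approximation by closed sets becomes approximation by compact sets after intersection with
    [S], since [sigma] does not charge the complement of [S]. *)
Lemma radon_plus_finite (R : realType) (d : nat) (S : set 'rV[R]_d)
    (sigma : {measure set (borelType 'rV[R]_d) -> \bar R}) :
  compact S -> sigma (~` S) = 0%E -> (sigma S < +oo)%E -> radon_plus S sigma.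
Proof.
move=> cS nS Soo; have hE := @norm_hausdorff R 'rV[R]_d.
have mS : measurable (S : set (borelType 'rV[R]_d)).
  by apply: closed_borel; exact: compact_closed hE cS.
have sT : (sigma setT < +oo)%E.
  rewrite -(setUv S) measureU//; [|exact: measurableC|exact: setICr].
  have nSoo : (sigma (~` S) < +oo)%E by rewrite nS ltry.
  by apply: lte_add_pinfty => //; exact: nSoo.
have sfin (B : set (borelType 'rV[R]_d)) : measurable B -> (sigma B < +oo)%E.
  by move=> mB; apply: le_lt_trans sT; apply: le_measure; rewrite ?inE.
split => //; first by move=> B mB; rewrite ge0_fin_numE// sfin.
move=> B mB; apply/eqP; rewrite eq_le; apply/andP; split; last first.
  apply: ge_ereal_sup => _ [K [cK KB] <-]; apply: le_measure; rewrite ?inE//.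
  by apply: closed_borel; exact: compact_closed hE cK.
apply/lee_addgt0Pr => e e0.
have [F [U [cF oU FB BU UF]]] := borel_regular sT mB e0.
have mF : measurable (F : set (borelType 'rV[R]_d)) by exact: closed_borel.
have mU : measurable (U : set (borelType 'rV[R]_d)) by exact: open_borel.
apply: (@le_trans _ _ (sigma (F `&` S) + sigma (U `\` F))%E); last first.
  apply: leeD; last exact: ltW.
  apply: ereal_sup_ubound; exists (F `&` S) => //; split.
    by rewrite setIC; exact: compact_closedI.
  by move=> x [] /FB.
have FE : sigma F = sigma (F `&` S).
  rewrite (measureDI sigma mF mS) -[RHS]add0e; congr (_ + _)%E.
  apply/eqP; rewrite -measure_le0 -nS; apply: le_measure; rewrite ?inE//.
  - exact: measurableD.
  - exact: measurableC.
rewrite -FE -measureU//; [|exact: measurableD|by rewrite setDE setICA setICr setI0].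
apply: le_measure; rewrite ?inE//; first by apply: measurableU => //; exact: measurableD.
by move=> x Bx; have [Fx|nFx] := pselect (F x); [left|right; split => //; exact: BU].
Qed.

Lemma finite_borel (T : ptopologicalType) (B : set T) : accessible_space T ->
  finite_set B -> measurable (B : set (borelType T)).
Proof.
move=> hT fB; rewrite (_ : B = \bigcup_(x in B) [set x]); last first.
  by apply/seteqP; split => [x Bx|x [y By ->//]]; exists x.
apply: fin_bigcup_measurable => // x _; apply: closed_borel.
exact: accessible_closed_set1.
Qed.

Lemma measurable_fun_finite_support (T : ptopologicalType) (d' : measure_display)
    (T' : measurableType d') (s : seq T) (c : T') (h : borelType T -> T') :
  accessible_space T -> (forall x, x \notin s -> h x = c) ->
  measurable_fun setT h.
Proof.
move=> hT hc _ B _; rewrite setTI.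
have fin_s (C : set T) : C `<=` [set` s] -> measurable (C : set (borelType T)).
  by move=> Cs; apply: finite_borel => //; apply: sub_finite_set Cs _; exact: finite_seq.
have [Bc|nBc] := pselect (B c).
  rewrite -[_ @^-1` _]setCK; apply: measurableC; apply: fin_s => x /= nBx.
  by apply/negP => /negP xs; apply: nBx; rewrite hc.
by apply: fin_s => x /= Bx; apply/negP => /negP xs; apply: nBc; rewrite -(hc x).
Qed.

(** * Positive functionals as curves *)

Section positive_functional.
Context {R : realType} {T : Type} (K : set T).

Definition bounded_on (phi : T -> R) :=
  exists M : R, forall z, K z -> `|phi z| <= M.

Definition positive_functional (L : (T -> R) -> R) :=
  [/\ forall phi psi, bounded_on phi -> bounded_on psi ->
        L (phi \+ psi) = L phi + L psi,
      forall c phi, bounded_on phi -> L (c \*o phi) = c * L phi &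
      forall phi psi, bounded_on phi -> bounded_on psi ->
        (forall z, K z -> phi z <= psi z) -> L phi <= L psi].

Lemma bounded_on_indic Q : bounded_on \1_Q.
Proof.
exists 1 => z _; rewrite indicE ger0_norm ?ler0n//.
by case: (_ \in _); rewrite ?ler01.
Qed.

Lemma bounded_on_mul phi psi : bounded_on phi -> bounded_on psi ->
  bounded_on (phi \* psi).
Proof.
move=> [M phiM] [N psiN]; exists (M * N) => z Kz /=.
by rewrite normrM ler_pM// ?phiM ?psiN.
Qed.

Lemma bounded_onZ c phi : bounded_on phi -> bounded_on (c \*o phi).
Proof.
move=> [M phiM]; exists (`|c| * M) => z Kz /=.
by rewrite normrM ler_wpM2l// phiM.
Qed.

Section tree.
Context (L : (T -> R) -> R) (hL : positive_functional L) (W : nat -> set T).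
Implicit Types (phi : T -> R) (Q : set T) (st : R * set T).

Definition mass Q : R := L \1_Q.

Definition moment phi Q : R := L (phi \* \1_Q).

Lemma mass_ge0 Q : 0 <= mass Q.
Proof.
have [_ LZ Lle] := hL; have <- : L (0 \*o \1_Q) = 0.
  by rewrite LZ ?mul0r//; exact: bounded_on_indic.
apply: Lle; [exact/bounded_onZ/bounded_on_indic|exact: bounded_on_indic|].
by move=> z _ /=; rewrite mul0r indicE ler0n.
Qed.

Lemma moment_split phi Q V : bounded_on phi ->
  moment phi Q = moment phi (Q `&` ~` V) + moment phi (Q `&` V).
Proof.
move=> bphi; have [LD _ _] := hL; rewrite /moment -LD; last 2 first.
- by apply: bounded_on_mul => //; exact: bounded_on_indic.
- by apply: bounded_on_mul => //; exact: bounded_on_indic.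
congr L; apply/funext => z /=; rewrite -mulrDr; congr (_ * _).
rewrite !indicE !in_setI in_setC.
by case: (z \in Q); case: (z \in V); rewrite /= ?addr0 ?add0r.
Qed.

Lemma mass_split Q V : mass Q = mass (Q `&` ~` V) + mass (Q `&` V).
Proof.
have b1 : bounded_on (cst 1) by exists 1 => z _; rewrite normr1.
have m1 Q' : moment (cst 1) Q' = mass Q'.
  by congr L; apply/funext => z /=; rewrite mul1r.
by rewrite -!m1; exact: moment_split.
Qed.

Lemma moment_le phi Q c : bounded_on phi ->
  (forall z, K z -> Q z -> phi z <= c) -> moment phi Q <= c * mass Q.
Proof.
move=> bphi phic; have [_ LZ Lle] := hL; rewrite /mass -LZ; last first.
  exact: bounded_on_indic.
apply: Lle; [|exact/bounded_onZ/bounded_on_indic|].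
  by apply: bounded_on_mul => //; exact: bounded_on_indic.
move=> z Kz /=; rewrite indicE; have [/set_mem Qz|_] := boolP (z \in Q).
  by rewrite !mulr1 phic.
by rewrite !mulr0.
Qed.

Lemma moment_ge phi Q c : bounded_on phi ->
  (forall z, K z -> Q z -> c <= phi z) -> c * mass Q <= moment phi Q.
Proof.
move=> bphi phic; have [_ LZ Lle] := hL; rewrite /mass -LZ; last first.
  exact: bounded_on_indic.
apply: Lle; [exact/bounded_onZ/bounded_on_indic| |].
  by apply: bounded_on_mul => //; exact: bounded_on_indic.
move=> z Kz /=; rewrite indicE; have [/set_mem Qz|_] := boolP (z \in Q).
  by rewrite !mulr1 phic.
by rewrite !mulr0.
Qed.

Lemma mass_nonempty Q : 0 < mass Q -> exists2 z, K z & Q z.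
Proof.
move=> Q0; apply: contrapT => nKQ; move: Q0; rewrite ltNge => /negP; apply.
have [_ LZ Lle] := hL; rewrite -(mul0r (L \1_Q)) -LZ; last exact: bounded_on_indic.
apply: Lle; [exact: bounded_on_indic|exact/bounded_onZ/bounded_on_indic|].
move=> z Kz /=; rewrite mul0r indicE memNset// => Qz.
by apply: nKQ; exists z.
Qed.

Definition average phi Q : R := moment phi Q / mass Q.

Lemma average_bound phi Q M : bounded_on phi -> 0 <= M ->
  (forall z, K z -> `|phi z| <= M) -> `|average phi Q| <= M.
Proof.
move=> bphi M0 phiM; have := mass_ge0 Q; rewrite le_eqVlt => /predU1P[m0|m0].
  by rewrite /average -m0 invr0 mulr0 normr0.
rewrite ler_norml /average ler_pdivlMr// ler_pdivrMr//; apply/andP; split.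
  by apply: moment_ge => // z Kz _; have := phiM _ Kz; rewrite ler_norml => /andP[].
by apply: moment_le => // z Kz _; have := phiM _ Kz; rewrite ler_norml => /andP[].
Qed.

(* The state [(b, Q)] stands for the cell [Q], to which the interval
   [[b, b + mass Q[] of the parameter space is assigned. *)
Definition next (n : nat) st (t : R) : R * set T :=
  let m := mass (st.2 `&` ~` W n) in
  if t < st.1 + m then (st.1, st.2 `&` ~` W n) else (st.1 + m, st.2 `&` W n).

(** The sets [W n], [W n.+1], ... split the cell in turn, and [t] always follows the half whose
    subinterval contains it. *)
Fixpoint run (k n : nat) st (t : R) : R * set T :=
  if k is k'.+1 then run k' n.+1 (next n st t) t else st.

Lemma runSr k n st t : run k.+1 n st t = next (n + k)%N (run k n st t) t.
Proof.
elim: k n st => [|k IH] n st; first by rewrite addn0.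
by have -> : run k.+2 n st t = run k.+1 n.+1 (next n st t) t by []; rewrite IH addSnnS.
Qed.

Definition cell_itv st : set R := `[st.1, (st.1 + mass st.2)[%classic.

Lemma cell_itv_next n st t : cell_itv st t -> cell_itv (next n st t) t.
Proof.
rewrite /cell_itv /next /= !in_itv/= => /andP[t1 t2]; case: ltP => ht /=.
  by rewrite t1 ht.
by rewrite ht -addrA -mass_split.
Qed.

Lemma cell_itv_measure st : lebesgue_measure (cell_itv st) = (mass st.2)%:E.
Proof.
rewrite /cell_itv lebesgue_measure_itv/= lte_fin ltrDl.
have := mass_ge0 st.2; rewrite le_eqVlt => /predU1P[m0|m0].
  by rewrite -m0 ltxx.
by rewrite m0 -EFinB addrAC subrr add0r.
Qed.

(** The averages over successive cells behave like a martingale of step functions: splitting a cell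
    splits its interval in proportion to the masses, so the integral never changes. *)
Lemma run_integral phi k n st : bounded_on phi ->
  measurable_fun (cell_itv st) (fun t => average phi (run k n st t).2) /\
  (\int[lebesgue_measure]_(t in cell_itv st) (average phi (run k n st t).2)%:E =
   (moment phi st.2)%:E)%E.
Proof.
move=> bphi; elim: k n st => [|k IH] n st /=.
  split; first exact: measurable_cst.
  have -> : (\int[lebesgue_measure]_(t in cell_itv st) (average phi st.2)%:E =
     \int[lebesgue_measure]_(t in cell_itv st) (cst (average phi st.2)%:E) t)%E by [].
  rewrite integral_cst//; last exact: measurable_itv.
  rewrite -[X in (_ * X)%E]/(lebesgue_measure (cell_itv st)) cell_itv_measure.
  rewrite -EFinM /average; have := mass_ge0 st.2; rewrite le_eqVlt => /predU1P[m0|m0].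
    (* On a null cell the quotient defining the average is 0 by convention; the moment vanishes as
       well, being squeezed between [- M] and [M] times the mass. *)
    rewrite -m0 mulr0; congr EFin; apply/esym/eqP.
    have [M phiM] := bphi.
    have h z : K z -> - M <= phi z <= M by move=> /phiM; rewrite ler_norml.
    rewrite eq_le -(mulr0 M) m0 moment_le//=; last by move=> z /h/andP[].
    rewrite -m0 mulr0 -(mulr0 (- M)) m0 moment_ge// => z /h/andP[].
    by [].
  by rewrite divfK// gt_eqF.
pose m := mass (st.2 `&` ~` W n).
pose sl := (st.1, st.2 `&` ~` W n); pose sr := (st.1 + m, st.2 `&` W n).
have m0 : 0 <= m by exact: mass_ge0.
have stU : cell_itv st = cell_itv sl `|` cell_itv sr.
  rewrite /cell_itv/= (mass_split st.2 (W n)) -/m addrA.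
  by rewrite -itv_bndbnd_setU// bnd_simp ?lerDl ?mass_ge0.
have disj : [disjoint cell_itv sl & cell_itv sr].
  apply/disj_setPS => t []; rewrite /cell_itv/= !in_itv/= => /andP[_ t1] /andP[t2 _].
  by move: t1; rewrite ltNge t2.
have nl t : cell_itv sl t -> next n st t = sl.
  by rewrite /cell_itv/= in_itv/= /next => /andP[_ ->].
have nr t : cell_itv sr t -> next n st t = sr.
  by rewrite /cell_itv/= in_itv/= /next => /andP[h _]; rewrite ltNge h.
have ml : measurable (cell_itv sl) by exact: measurable_itv.
have mr : measurable (cell_itv sr) by exact: measurable_itv.
have [mfl il] := IH n.+1 sl; have [mfr ir] := IH n.+1 sr.
have mfl' : measurable_fun (cell_itv sl) (fun t => average phi (run k n.+1 (next n st t) t).2).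
  by apply: eq_measurable_fun mfl => t /set_mem/nl ->.
have mfr' : measurable_fun (cell_itv sr) (fun t => average phi (run k n.+1 (next n st t) t).2).
  by apply: eq_measurable_fun mfr => t /set_mem/nr ->.
have mf : measurable_fun (cell_itv st) (fun t => average phi (run k n.+1 (next n st t) t).2).
  by rewrite stU; apply/measurable_funU.
split => //; rewrite stU integral_setU_EFin//; last by rewrite -stU.
rewrite (moment_split st.2 (W n) bphi) EFinD; congr (_ + _)%E.
  by rewrite -il; apply: eq_integral => t /set_mem/nl ->.
by rewrite -ir; apply: eq_integral => t /set_mem/nr ->.
Qed.

Section representation.
Context (I : countType) (e : I -> T -> R) (z0 : T) (Kz0 : K z0).
Hypothesis be : forall i, bounded_on (e i).
Hypothesis compactK : forall z : nat -> T, (forall n, K (z n)) ->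
  exists (h : nat -> nat) (a : T), [/\ forall k, (k <= h k)%N, K a &
    forall i, e i (z (h k)) @[k --> \oo] --> e i a].
(** All superlevel sets of the coordinates at rational thresholds, so that deep cells localize every
    coordinate. *)
Hypothesis WE : forall n, W n =
  if unpickle n is Some (i, r) then [set z | ratr (r : rat) <= e i z] else set0.

Definition root : R * set T := (0, setT).

Let cell k t := (run k 0 root t).2.

Let cell_le k l t : (k <= l)%N -> cell l t `<=` cell k t.
Proof.
move=> /subnK <-; elim: (l - k)%N => [|m IH]; first by rewrite add0n.
apply: subset_trans IH; rewrite addSn /cell runSr /next.
by case: ifP => _ /= z [].
Qed.

Let cell_nonempty k t : cell_itv root t -> exists2 z, K z & cell k t z.
Proof.
move=> Dt; apply: mass_nonempty.
have : cell_itv (run k 0 root t) t.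
  by elim: k => [//|k IH]; rewrite runSr; exact: cell_itv_next.
rewrite /cell_itv/= in_itv/= => /andP[t1 t2].
by rewrite -(ltrD2l (run k 0 root t).1) addr0 (le_lt_trans t1).
Qed.

Let cell_decides n t : cell n.+1 t `<=` W n \/ cell n.+1 t `<=` ~` W n.
Proof.
rewrite /cell runSr add0n /next; case: ifP => _ /=; first by right => z [].
by left => z [].
Qed.

(** The cells along [t] are nested and each contains an admissible point; [z] is a limit of such
    points. Once a cell has been split at a rational threshold, all of it lies on one side, and the
    limit [z] tells which. Two thresholds around [e i z] thus trap [e i] on all later cells, hence
    its averages. *)
Let average_cvg t : exists z, K z /\ (cell_itv root t ->
  forall i, average (e i) (cell k t) @[k --> \oo] --> e i z).
Proof.
have [Dt|nDt] := pselect (cell_itv root t); last by exists z0.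
have /choice[z zP] k : exists z, K z /\ cell k t z.
  by have [z] := cell_nonempty k Dt; exists z.
have [h [a [hk Ka za]]] := compactK (fun n => (zP n).1).
have zcell n k : (n <= k)%N -> cell n t (z (h k)).
  by move=> nk; apply: (cell_le _ (zP (h k)).2); rewrite (leq_trans nk).
exists a; split => // _ i; apply/cvgrPdist_le => eps e0.
have [r1] : exists r, ratr r \in `](e i a - eps), (e i a)[.
  by apply: rat_in_itvoo; rewrite ltrBlDr ltrDl.
rewrite in_itv/= => /andP[r1l r1u].
have [r2] : exists r, ratr r \in `](e i a), (e i a + eps)[.
  by apply: rat_in_itvoo; rewrite ltrDl.
rewrite in_itv/= => /andP[r2l r2u].
pose n1 := pickle (i, r1); pose n2 := pickle (i, r2).
have c1 : cell n1.+1 t `<=` W n1.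
  have [//|nW] := cell_decides n1 t; exfalso.
  have : \forall k \near \oo, ratr r1 < e i (z (h k)).
    by apply: (cvgr_gt _ (za i)).
  move=> [N _ /(_ (maxn N n1.+1))] /=; rewrite leq_maxl => /(_ isT) r1z.
  have /nW := zcell n1.+1 _ (leq_maxr N n1.+1); rewrite WE pickleK/= => nr1.
  exact: nr1 (ltW r1z).
have c2 : cell n2.+1 t `<=` ~` W n2.
  have [cW|//] := cell_decides n2 t; exfalso.
  have : \forall k \near \oo, e i (z (h k)) < ratr r2.
    by apply: (cvgr_lt _ (za i)).
  move=> [N _ /(_ (maxn N n2.+1))] /=; rewrite leq_maxl => /(_ isT) r2z.
  have /cW := zcell n2.+1 _ (leq_maxr N n2.+1); rewrite WE pickleK/= => r2z'.
  by move: r2z; rewrite ltNge r2z'.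
near=> k.
have k1 : (n1.+1 <= k)%N by near: k; exact: nbhs_infty_ge.
have k2 : (n2.+1 <= k)%N by near: k; exact: nbhs_infty_ge.
have mpos : 0 < mass (cell k t).
  have : cell_itv (run k 0 root t) t.
    elim: (k) => [//|k' IH]; rewrite runSr; exact: cell_itv_next.
  rewrite /cell_itv/= in_itv/= => /andP[t1 t2].
  by rewrite -(ltrD2l (run k 0 root t).1) addr0 (le_lt_trans t1).
have av1 : ratr r1 <= average (e i) (cell k t).
  rewrite /average ler_pdivlMr//; apply: moment_ge => // y Ky /(cell_le k1)/c1.
  by rewrite WE pickleK.
have av2 : average (e i) (cell k t) <= ratr r2.
  rewrite /average ler_pdivrMr//; apply: moment_le => // y Ky /(cell_le k2)/c2.
  by rewrite WE pickleK/= => /negP; rewrite -ltNge => /ltW.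
by rewrite ler_norml; apply/andP; split; lra.
Unshelve. all: by end_near. Qed.

(* A positive functional on a sequentially compact set is integration along a
   curve parametrized by an interval: this plays the role of the Riesz
   representation theorem. *)
Lemma representation : exists G : R -> T, (forall t, K (G t)) /\
  forall i, measurable_fun (cell_itv root) (fun t => e i (G t)) /\
    (\int[lebesgue_measure]_(t in cell_itv root) (e i (G t))%:E =
     (L (e i))%:E)%E.
Proof.
have /choice[G GP] := average_cvg; exists G; split; first by move=> t; have [] := GP t.
move=> i; have [M0 M0P] := be i; pose M := `|M0|.
have MP z : K z -> `|e i z| <= M by move=> Kz; rewrite (le_trans (M0P _ Kz))// ler_norm.
have D_m : measurable (cell_itv root) by exact: measurable_itv.
have mav k : measurable_fun (cell_itv root) (fun t => average (e i) (cell k t)).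
  by have [] := run_integral k 0 root (be i).
have cav t : cell_itv root t -> average (e i) (cell k t) @[k --> \oo] --> e i (G t).
  by move=> Dt; have [_ /(_ Dt)] := GP t; apply.
have mG : measurable_fun (cell_itv root) (fun t => e i (G t)).
  exact: (measurable_fun_cvg mav cav).
split => //.
have Doo : (lebesgue_measure (cell_itv root) < +oo)%E.
  by rewrite /cell_itv lebesgue_measure_itv/=; case: ifP; rewrite ltry.
have iM : lebesgue_measure.-integrable (cell_itv root) (EFin \o cst M).
  by apply: measurable_bounded_integrable => //; exact: bounded_cst.
have [] := @dominated_convergence _ _ _ lebesgue_measure _ D_m
  (fun k t => (average (e i) (cell k t))%:E) (fun t => (e i (G t))%:E) (EFin \o cst M).
- by move=> k; apply/measurable_EFinP; exact: mav.
- by apply/measurable_EFinP; exact: mG.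
- apply: aeW => t Dt; apply: cvg_EFin; first exact: nearW.
  exact: cav.
- exact: iM.
- apply: aeW => t k Dt; rewrite /= lee_fin.
  by apply: average_bound => //; exact: normr_ge0.
move=> _ _ /cvg_lim <-//; apply: cvg_lim => //.
(* Every term of the sequence of integrals already equals the moment of the root cell. *)
rewrite [X in X @ _](_ : _ = cst (L (e i))%:E); first exact: cvg_cst.
apply/funext => k /=; have [_ ->] := run_integral k 0 root (be i).
congr (L _)%:E; apply/funext => z /=; rewrite indicT.
by rewrite mulr1.
Qed.

End representation.
End tree.
End positive_functional.

(** * Conditional expectations as Radon-Nikodym densities *)

Section conditional_density.
Context {R : realType} {d1 d2 : measure_display}.
Context {T1 : measurableType d1} {T2 : measurableType d2}.
Context (la : {measure set T1 -> \bar R}) (g : T1 -> T2).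
Hypothesis mg : measurable_fun setT g.

Lemma image_measure : exists sigma : {measure set T2 -> \bar R},
  forall B, sigma B = la (g @^-1` B).
Proof.
by exists (measure_function_pushforward__canonical__measure_function_Measure la mg).
Qed.

(** The signed measure with density [w] is pushed forward by [g]; the third hypothesis is its
    absolute continuity with respect to [sigma]. *)
Lemma conditional_density (sigma : {measure set T2 -> \bar R}) (w : T1 -> R) :
  (sigma setT < +oo)%E -> la.-integrable setT (EFin \o w) ->
  (forall B, measurable B -> sigma B = 0%E ->
     (\int[la]_(x in g @^-1` B) (w x)%:E = 0)%E) ->
  exists rho : T2 -> R, sigma.-integrable setT (EFin \o rho) /\
    forall B, measurable B ->
      (\int[sigma]_(y in B) (rho y)%:E = \int[la]_(x in g @^-1` B) (w x)%:E)%E.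
Proof.
move=> soo iw sw.
pose sF : {finite_measure set T2 -> \bar R} := mfrestr measurableT soo.
have sigmaE : sigma = sF.
  by apply: eq_measure; apply/funext => B; rewrite /= /mfrestr /mrestr setIT.
pose nu := measure_function_pushforward__canonical__charge_Charge (induced_charge iw) mg.
have nuE B : nu B = (\int[la]_(x in g @^-1` B) (w x)%:E)%E by [].
have dom : nu `<< sF.
  apply/null_content_dominatesP => B mB sB0; rewrite nuE.
  by apply: sw => //; rewrite sigmaE.
exists (fine \o Radon_Nikodym nu sF).
have RNE y : (fine (Radon_Nikodym nu sF y))%:E = Radon_Nikodym nu sF y.
  by rewrite fineK// Radon_Nikodym_fin_num.
rewrite sigmaE; split.
  apply: (eq_integrable _ (Radon_Nikodym nu sF)) => //; last exact: Radon_Nikodym_integrable.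
  by move=> y _ /=; rewrite RNE.
move=> B mB; under eq_integral do rewrite RNE.
by rewrite -nuE (Radon_Nikodym_integral dom mB).
Qed.

End conditional_density.

(** * Pettis measurability *)

Section pettis.
Context {R : realType} {dT : measure_display} {T : measurableType dT}.
Context {Xs X : completeNormedModType R}.
Context (pr : {bilinear Xs -> X -> R | *%R & *%R}) (hpr : is_predual pr).
Context (P : nat -> Xs) (hP : norming_seq pr P).

Lemma measurable_norm_norming (u : T -> X) :
  (forall i, measurable_fun setT (fun t => pr (P i) (u t))) ->
  measurable_fun setT (fun t => `|u t|).
Proof.
move=> mu; apply/measurable_EFinP.
have -> : EFin \o (fun t => `|u t|) =
    fun t => ereal_sup [set (pr (P i) (u t))%:E | i in setT].
  apply/funext => t /=; apply/eqP; rewrite eq_le; apply/andP; split.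
    apply/lee_addgt0Pr => e e0; have [i] := hP.2 (u t) e e0.
    rewrite ltrBlDr -lte_fin EFinD => /ltW/le_trans; apply.
    by rewrite leeD2r//; apply: ereal_sup_ubound; exists i.
  apply: ge_ereal_sup => _ [i _ <-]; rewrite lee_fin (le_trans (ler_norm _))//.
  by rewrite (le_trans (pairing_le hpr _ _))// -[leRHS]mul1r ler_wpM2r// hP.1.
rewrite (_ : (fun t => _) = fun t => esups (fun i => (pr (P i) (u t))%:E) 0%N).
  by apply: measurable_fun_esups => i; apply/measurable_EFinP; exact: mu.
apply/funext => t; rewrite /esups/= /sdrop; congr ereal_sup.
by apply/seteqP; split => [_ [i _ <-]|_ [i _ <-]]; exists i.
Qed.

Lemma separable_seq : separable X -> exists x : nat -> X, x 0%N = 0 /\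
  forall v (e : R), 0 < e -> exists n, `|v - x n| < e.
Proof.
move=> [D cD dD].
have /countable_injP[f finj] := cD.
pose x n := if n is m.+1 then xget 0 [set x | D x /\ f x = m] else 0.
exists x; split => // v e e0.
have [y [vy Dy]] := dD (ball v e) (ex_intro _ v (ballxx v e0)) (ball_open v e).
exists (f y).+1; rewrite /x; case: xgetP => [z zE [Dz fz]|/(_ y)]; last by case.
by rewrite (finj _ _ _ _ fz) ?inE//; move: vy; rewrite -ball_normE.
Qed.

(* Pettis: the [n]-th approximation takes the value, among the first [n + 1] points
   of a dense sequence, that is closest to [u t]. *)
Lemma strongly_measurable_norming (u : T -> X) : separable X ->
  (forall i, measurable_fun setT (fun t => pr (P i) (u t))) ->
  exists g : nat -> T -> X, [/\ forall n, simple_function (g n),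
    forall t, g n t @[n --> \oo] --> u t &
    forall n t, `|u t - g n t| <= `|u t|].
Proof.
move=> sX mu; have [x [x0 xd]] := separable_seq sX.
have mdist n : measurable_fun setT (fun t => `|u t - x n|).
  apply: measurable_norm_norming => i.
  rewrite (_ : (fun t => _) = fun t => pr (P i) (u t) - pr (P i) (x n)).
    by apply: measurable_funB => //; exact: measurable_cst.
  by apply/funext => t; rewrite linearBr.
pose g := fix g n t := if n is m.+1 then
  (if `|u t - x m.+1| < `|u t - g m t| then x m.+1 else g m t) else x 0%N.
have gdist n t : forall k, (k <= n)%N -> `|u t - g n t| <= `|u t - x k|.
  elim: n => [|n IH] k; first by rewrite leqn0 => /eqP->.
  rewrite leq_eqVlt ltnS /= => /predU1P[->|kn]; case: ltP => //.
  - by move=> /ltW/le_trans; apply; exact: IH.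
  - by move=> _; exact: IH.
(* Here [x 0%N = 0] matters: the zero vector is always among the candidates, which gives a
   dominating function for the errors. *)
have gnorm n t : `|u t - g n t| <= `|u t|.
  by rewrite (le_trans (gdist n t _ (leq0n n)))// x0 subr0.
have gfin n : finite_set (range (g n)).
  elim: n => [|n IH].
    by apply: (@sub_finite_set _ _ [set x 0%N]) => // _ [t _ <-].
  apply: (@sub_finite_set _ _ (range (g n) `|` [set x n.+1])).
    by move=> _ [t _ <-] /=; case: ifP => _; [right|left; exists t].
  by rewrite finite_setU; split.
have mg n : (forall y, measurable (g n @^-1` [set y])) /\
    measurable_fun setT (fun t => `|u t - g n t|).
  elim: n => [|n [IH1 IH2]] /=.
    split; last exact: mdist.
    by move=> y; rewrite preimage_cst; case: ifP.
  pose B := [set t | `|u t - x n.+1| < `|u t - g n t|].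
  have mB : measurable B.
    have mt : measurable [set true] by [].
    rewrite -[B]setTI; exact: (measurable_fun_ltr (mdist n.+1) IH2 measurableT mt).
  split.
    move=> y; rewrite (_ : _ @^-1` _ = (B `&` [set t | x n.+1 = y]) `|` (~` B `&` g n @^-1` [set y])).
      apply: measurableU; apply: measurableI => //; last exact: measurableC.
      by have [->|xy] := pselect (x n.+1 = y); [rewrite (_ : [set _ | _] = setT)//; apply/seteqP; split|rewrite (_ : [set _ | _] = set0)//; apply/seteqP; split].
    apply/seteqP; split => [t /=|t [[Bt /= xy]|[nBt /= gy]] /=].
    - by case: ifPn => [Bt xy|/negP nBt gy]; [left|right].
    - by rewrite /B/= in Bt; rewrite Bt.
    - by case: ifPn.
  rewrite (_ : (fun t => _) = fun t => Num.min `|u t - x n.+1| `|u t - g n t|).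
    exact: measurable_minr.
  by apply/funext => t; rewrite /Num.min; case: ifP.
exists g; split => //.
- move=> n; split; last exact: gfin.
  move=> _ B mB; rewrite setTI (_ : _ @^-1` _ = \bigcup_(y in range (g n) `&` B) g n @^-1` [set y]).
    apply: fin_bigcup_measurable; first exact: finite_setIl.
    by move=> y _; have [] := mg n.
  apply/seteqP; split => [t Bt|t [y [_ By]] /= gy]; last by rewrite gy.
  by exists (g n t) => //; split => //; exists t.
- move=> t; apply/cvgrPdist_lt => e e0; have [k xk] := xd (u t) e e0.
  by near=> n; rewrite (le_lt_trans (gdist n t k _))//; near: n; exact: nbhs_infty_ge.
Unshelve. all: by end_near. Qed.

(** Scalar integrals against the norming sequence determine the Bochner integral: each [pr (P i)] of
    the error between [v] and a simple integral is at most the mean distance from [u] to the simple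
    function, a bound uniform in [i] that therefore controls the norm. *)
Lemma bochner_of_norming (mu : {measure set T -> \bar R}) (D : set T)
    (u : T -> X) (v : X) (C : R) :
  separable X -> measurable D -> (mu D < +oo)%E ->
  (forall i, measurable_fun setT (fun t => pr (P i) (u t))) ->
  (forall t, `|u t| <= C) ->
  (forall i, \int[mu]_(t in D) (pr (P i) (u t))%:E = (pr (P i) v)%:E)%E ->
  bochner_L1 mu D u /\ has_bochner_integral mu D u v.
Proof.
move=> sX mD muD mpu uC uv.
have [g [sg gu gnorm]] := strongly_measurable_norming sX mpu.
have mnu := measurable_norm_norming mpu.
have iC : mu.-integrable D (EFin \o cst C).
  by apply: measurable_bounded_integrable => //; exact: bounded_cst.
have uL : bochner_L1 mu D u.
  split; first by exists g; split => // t _; exact: gu.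
  apply: (@le_lt_trans _ _ (\int[mu]_(t in D) (cst C%:E) t)%E).
    by apply: ge0_le_lower_integral => // t _; rewrite lee_fin.
  rewrite integral_cst//; move: muD; rewrite -ge0_fin_numE// => /fineK <-.
  by rewrite -EFinM ltry.
split => //.
have mgn n : measurable_fun setT (fun t => `|u t - g n t|).
  apply: measurable_norm_norming => i.
  rewrite (_ : (fun t => _) = fun t => pr (P i) (u t) - (pr (P i) \o g n) t).
    by apply: measurable_funB => //; exact: simple_function_comp.
  by apply/funext => t; rewrite /= linearBr.
have lim0 : (\int[mu]_(t in D) `|u t - g n t|%:E)%E @[n --> \oo] --> 0%E.
  have [] := @dominated_convergence _ _ _ mu _ mD
    (fun n t => `|u t - g n t|%:E) (cst 0%E) (EFin \o cst C).
  - by move=> n; apply/measurable_EFinP; exact: measurable_funTS.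
  - exact: measurable_cst.
  - apply: aeW => t _; apply: cvg_EFin; first exact: nearW.
    rewrite -(@normr0 _ X) -(subrr (u t)); apply: cvg_norm.
    by apply: cvgB; [exact: cvg_cst|exact: gu].
  - exact: iC.
  - by apply: aeW => t n _; rewrite /= lee_fin normr_id (le_trans (gnorm _ _)).
  by move=> _ _; rewrite integral0.
exists g; split => //.
apply/cvgrPdist_le => e e0.
have : \forall n \near \oo, (\int[mu]_(t in D) `|u t - g n t|%:E < e%:E)%E.
  exact: cvge0_lt lim0 e0.
apply: filterS => n ne; apply: (norm_le_norming hP) => i.
have iu := bochner_pairing_integrable hpr (P i) mD uL.
have ign : mu.-integrable D (fun t => (pr (P i) (g n t))%:E).
  exact: (simple_integrable (pr (P i)) mD muD (sg n)).
rewrite linearBr/= -lee_fin EFinB -uv -(pairing_simple_integral pr (P i) mD muD (sg n)).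
rewrite -integralB_EFin//; apply: (le_trans _ (ltW ne)).
apply: (@le_trans _ _ (\int[mu]_(t in D) `|((pr (P i) (u t))%:E - (pr (P i) (g n t))%:E)|)%E).
  apply: (le_trans (lee_abs _)); apply: le_abse_integral => //.
  by apply: emeasurable_funB; [exact: measurable_int iu|exact: measurable_int ign].
apply: ge0_le_lower_integral => // t _.
rewrite -EFinB -linearBr lee_fin (le_trans (pairing_le hpr _ _))//.
by rewrite -[leRHS]mul1r ler_wpM2r// hP.1.
Qed.

End pettis.

(** * Auxiliary measurability facts and scalar inequalities *)

Lemma measurable_fun_rV (R : realType) (d : nat) (dT : measure_display)
    (T : measurableType dT) (g : T -> 'rV[R]_d) :
  (forall j, measurable_fun setT (fun t => g t ord0 j)) ->
  measurable_fun setT (g : T -> borelType 'rV[R]_d).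
Proof.
move=> mg; apply: (@measurability _ _ T (borelType 'rV[R]_d) setT g (@open 'rV[R]_d)) => //.
move=> _ [U oU <-]; rewrite setTI.
pose box (cn : 'rV[rat]_d * nat) : set 'rV[R]_d :=
  \bigcap_(j in setT) [set x | `|ratr (cn.1 ord0 j) - x ord0 j| < cn.2.+1%:R^-1].
pose F (cn : 'rV[rat]_d * nat) : set T :=
  if `[< box cn `<=` U >] then g @^-1` box cn else set0.
have -> : g @^-1` U = \bigcup_cn F cn.
  apply/seteqP; split => [t Ut|t [cn _]]; last first.
    by rewrite /F; case: asboolP => // cnU; exact: cnU.
  have := oU; rewrite openE => /(_ _ Ut) /nbhs_ballP[e /= e0 eU].
  have e2 : 0 < e / 2 by rewrite divr_gt0.
  have [n _ /(_ n (leqnn _)) ne] := near_infty_natSinv_lt (PosNum e2).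
  have n0 : 0 < n.+1%:R^-1 :> R by rewrite invr_gt0.
  have /choice[q qP] (j : 'I_d) :
      exists q, ratr q \in `](g t ord0 j - n.+1%:R^-1), (g t ord0 j + n.+1%:R^-1)[.
    by apply: rat_in_itvoo; rewrite ltrBlDr -addrA ltrDl addr_gt0.
  exists (\row_j q j, n) => //; rewrite /F.
  have tbox : box (\row_j q j, n) (g t).
    move=> j _ /=; rewrite mxE; have := qP j; rewrite in_itv/= => /andP[q1 q2].
    by move: (n.+1%:R^-1) q1 q2 => z q1 q2; rewrite ltr_norml; apply/andP; split; lra.
  case: asboolP => // -[]; apply: subset_trans eU => x xbox.
  split => // i j; rewrite (ord1 i) -ball_normE/=.
  have := xbox j Logic.I; have := tbox j Logic.I; rewrite /= => h1 h2.
  rewrite (le_lt_trans (ler_distD (ratr ((\row_j q j) ord0 j)) _ _))//.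
  by rewrite distrC (splitr e) ltrD// (lt_trans _ ne).
apply: countable_bigcupT_measurable => [|cn]; first exact: countableP.
rewrite /F; case: asboolP => // _; rewrite /box preimage_bigcap.
apply: fin_bigcap_measurable => // j _.
rewrite -[X in measurable X]setTI.
have mc : measurable_fun setT (fun t => `|ratr (cn.1 ord0 j) - g t ord0 j|).
  by apply: measurableT_comp => //; apply: measurable_funB => //; exact: measurable_cst.
have mlt := measurable_fun_ltr mc (measurable_cst (cn.2.+1%:R^-1 : R)).
have mt : measurable [set true] by [].
exact: (mlt measurableT _ mt).
Qed.

Lemma measurable_fun_patch (d1 d2 : measure_display) (T1 : measurableType d1)
    (T2 : measurableType d2) (D : set T1) (h : T1 -> T2) (c : T2) :
  measurable D -> measurable_fun D h ->
  measurable_fun setT (fun t => if t \in D then h t else c).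
Proof.
move=> mD mh; rewrite -(setUv D); apply/measurable_funU => //.
  exact: measurableC.
split.
  by apply: eq_measurable_fun mh => t ->.
apply: (@eq_measurable_fun _ _ _ _ _ (cst c)); last exact: measurable_cst.
by move=> t /set_mem nDt; rewrite memNset.
Qed.

Lemma positive_integral_null (d : measure_display) (T : measurableType d)
    (R : realType) (mu : {measure set T -> \bar R}) (N : set T) (h : T -> R) :
  measurable N -> measurable_fun N h -> (forall t, N t -> 0 < h t) ->
  (\int[mu]_(t in N) (h t)%:E <= 0)%E -> mu N = 0%E.
Proof.
move=> mN mh h0 ih.
have : (\int[mu]_(t in N) `|(h t)%:E| = 0)%E.
  apply/eqP; rewrite eq_le; apply/andP; split; last exact: integral_ge0.
  rewrite (eq_integral (fun t => (h t)%:E))// => t /set_mem Nt.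
  by rewrite gee0_abs// lee_fin ltW// h0.
have mh' : measurable_fun N (EFin \o h) by apply/measurable_EFinP.
move=> /(ae_eq_integral_abs mu mN mh').1 [A [mA A0 NA]].
apply/eqP; rewrite -measure_le0 -A0; apply: le_measure; rewrite ?inE//.
move=> t Nt; apply: NA => /= /(_ Nt) [] /eqP.
by rewrite gt_eqF// h0.
Qed.

Lemma cvg_ge_const (R : realType) (u : nat -> R) (l c : R) :
  u @ \oo --> l -> (forall n, c <= u n) -> c <= l.
Proof.
move=> ul cu; rewrite -(cvg_lim _ ul)//; apply: limr_ge; first exact: cvgP ul.
exact: nearW.
Qed.

Lemma limn_einf_le (R : realType) (u : nat -> \bar R) (c : \bar R) :
  (forall n, (u n <= c)%E) -> (limn_einf u <= c)%E.
Proof.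
move=> uc; rewrite limn_einf_lim; apply: lime_le; first exact: is_cvg_einfs.
apply: nearW => n; rewrite (le_trans _ (uc n))// ereal_inf_lbound//=.
by exists n => /=.
Qed.

Lemma segment_max (R : realDomainType) (a b m t : R) : 0 < t < 1 -> a <= m -> b <= m ->
  m = t * a + (1 - t) * b -> a = m /\ b = m.
Proof.
move=> /andP[t0 t1] am bm mE.
have : t * (m - a) + (1 - t) * (m - b) = 0 by lra.
have ta : 0 <= t * (m - a) by rewrite mulr_ge0 ?subr_ge0// ltW.
have tb : 0 <= (1 - t) * (m - b) by rewrite mulr_ge0 ?subr_ge0// ltW.
move/eqP; rewrite paddr_eq0// !mulf_eq0 !subr_eq0 gt_eqF//= [1 == t]gt_eqF//=.
by move=> /andP[/eqP-> /eqP->].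
Qed.

(** The step size is the classical [2 / (k + 2)]; with [2 * D <= M] the induction closes with the
    slack [M / ((k + 1) (k + 2)^2)]. *)
Lemma rate_step (R : realFieldType) (k : nat) (r r' D M : R) : 0 <= D -> 2 * D <= M ->
  (forall t, 0 <= t <= 1 -> r' <= (1 - t) * r + t ^+ 2 / 2 * D) ->
  r <= M / k.+1%:R -> r' <= M / k.+2%:R.
Proof.
move=> D0 DM step rM; have k0 : 0 <= k%:R :> R by exact: ler0n.
have t01 : (0 <= 2 / k.+2%:R :> R) && (2 / k.+2%:R <= 1 :> R).
  apply/andP; split; first by rewrite divr_ge0.
  by rewrite ler_pdivrMr ?ltr0n// mul1r ler_nat.
apply: le_trans (step _ t01) _.
have E2 : k.+2%:R = k%:R + 2 :> R by rewrite -natr1 -[k.+1%:R]natr1 -addrA.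
rewrite E2 in t01 *; move: rM; rewrite -natr1.
set x := k%:R in k0 * => rM.
have x1 : 0 < x + 1 by lra.
have x2 : 0 < x + 2 by lra.
have e1 : 1 - 2 / (x + 2) = x / (x + 2) by field; lra.
rewrite e1.
have : x / (x + 2) * r <= x / (x + 2) * (M / (x + 1)).
  by rewrite ler_wpM2l// divr_ge0// ltW.
have : (2 / (x + 2)) ^+ 2 / 2 * D <= M / (x + 2) ^+ 2.
  rewrite [leLHS](_ : _ = (2 * D) / (x + 2) ^+ 2); last by field; lra.
  by rewrite ler_pM2r// invr_gt0 exprn_gt0.
suff : x / (x + 2) * (M / (x + 1)) + M / (x + 2) ^+ 2 <= M / (x + 2) by lra.
rewrite -subr_ge0 [leRHS](_ : _ = M / ((x + 1) * (x + 2) ^+ 2)).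
  by rewrite divr_ge0 ?mulr_ge0 ?exprn_ge0 ?(ltW x1) ?(ltW x2)//; lra.
by field; rewrite !gt_eqF.
Qed.

(** First-order optimality: the quadratic is the change of an objective along a segment that starts
    at a minimizer. *)
Lemma le0_of_quadratic (R : realFieldType) (b c : R) :
  (forall t, 0 < t <= 1 -> 0 <= t * b + t ^+ 2 * c) -> 0 <= b.
Proof.
move=> h; rewrite leNgt; apply/negP => b0.
have c0 : 0 < c.
  have : 0 <= 1 * b + 1 ^+ 2 * c by apply: h; rewrite ltr01 lexx.
  by rewrite mul1r expr1n mul1r; lra.
(* The value [t = 1] has shown [c > 0]; for this smaller [t] the quadratic term absorbs at most half
   of the negative linear one. *)
pose t := Num.min 1 (- b / (c *+ 2)).
have t0 : 0 < t.
  by rewrite /t lt_min ltr01/= divr_gt0// ?oppr_gt0// pmulrn_lgt0.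
have t1 : t <= 1 by rewrite ge_min lexx.
have tb : t * c <= - b / 2.
  have : t <= - b / (c *+ 2) by rewrite ge_min lexx orbT.
  move/(ler_wpM2r (ltW c0)) => /le_trans; apply.
  by rewrite [leLHS](_ : _ = - b / 2)//; field; rewrite gt_eqF.
have := h t; rewrite t0 t1 => /(_ isT).
rewrite expr2 -mulrA -mulrDr pmulr_rge0//; lra.
Qed.

Lemma rat_approx (R : realType) (r : nat -> R) (n : nat) (e : R) : 0 < e ->
  exists c : seq rat, size c = n /\
    forall i, (i < n)%N -> `|ratr (nth 0 c i) - r i| < e.
Proof.
move=> e0; elim: n r => [|n IH] r; first by exists [::].
have [q] : exists q, ratr q \in `](r 0%N - e), (r 0%N + e)[.
  by apply: rat_in_itvoo; rewrite ltrBlDr -addrA ltrDl addr_gt0.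
rewrite in_itv/= => /andP[q1 q2]; have [c [cn cr]] := IH (fun i => r i.+1).
exists (q :: c); split; first by rewrite /= cn.
case=> [_|i]; last exact: cr.
by rewrite /= ltr_norml; apply/andP; split; lra.
Qed.

(** Rational coefficients leave countably many combinations, so the exceptional null sets of all
    linear inequalities can be united. *)
Definition combination (R : realType) (c : seq rat) (x : nat -> R) : R :=
  \sum_(i < size c) ratr (nth 0 c i) * x i.

Lemma integral_combination (R : realType) (dT : measure_display) (T : measurableType dT)
    (mu : {measure set T -> \bar R}) (B : set T) (c : seq rat) (h : nat -> T -> R) :
  measurable B -> (forall i, mu.-integrable B (EFin \o h i)) ->
  mu.-integrable B (fun t => (combination c (h ^~ t))%:E) /\
  (\int[mu]_(t in B) (combination c (h ^~ t))%:E =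
   \sum_(i < size c) (ratr (nth 0%R c i))%:E * \int[mu]_(t in B) (h i t)%:E)%E.
Proof.
move=> mB ih.
have ich (i : 'I_(size c)) :
    mu.-integrable B (fun t => (ratr (nth 0%R c i))%:E * (h i t)%:E)%E.
  by apply: integrableZl => //; exact: ih.
have cE t : (combination c (h ^~ t))%:E =
    (\sum_(i < size c) (ratr (nth 0%R c i))%:E * (h i t)%:E)%E.
  by rewrite -sumEFin.
split.
  apply: (eq_integrable mB (fun t => \sum_(i < size c) (ratr (nth 0%R c i))%:E * (h i t)%:E)%E).
    by move=> t _; rewrite cE.
  exact: (integrable_sum mB).
under eq_integral do rewrite cE.
rewrite integral_sum//; apply: eq_bigr => i _.
by rewrite integralZl//; exact: ih.
Qed.

(** * Atoms and extreme points *)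

Section problem.
Context {R : realType} {Xs X : completeNormedModType R} {d : nat}.
Context (pr : {bilinear Xs -> X -> R | *%R & *%R}) (hpr : is_predual pr).
Context (P : nat -> Xs) (hP : norming_seq pr P).
Context (S : set 'rV[R]_d) (hS : compact S) (J : X -> 'rV[R]_d -> \bar R).
Context (hJ : forall v s, S s -> (0 <= J v s)%E).
Context (alpha : R) (halpha : 0 < alpha).
Context (H1 : hypothesis_H1 S J) (H2 : hypothesis_H2 S J pr).
Context (H3 : hypothesis_H3 S J).

Local Notation E := 'rV[R]_d.

(** Whole balls rather than their extreme points: this set is sequentially compact, and its slice
    over each point of [S] is convex. *)
Definition atoms : set (X * E) :=
  [set q | S q.2 /\ sublevel_ball J alpha q.2 q.1].

Lemma J0 s : S s -> J 0 s = 0%E.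
Proof.
by move=> /H1[_ _ /(_ 0 0 (lexx _))]; rewrite scale0r mul0e.
Qed.

Lemma J_scale s (l : R) v : S s -> 0 <= l -> J (l *: v) s = (l%:E * J v s)%E.
Proof. by move=> /H1[_ _ +] l0; apply. Qed.

Lemma J_add s x y : S s -> (J (x + y)%R s <= J x s + J y s)%E.
Proof.
move=> Ss; have [_ /(_ (2 *: x) (2 *: y) 2^-1) + _] := H1 Ss.
have h0 : 0 <= 2^-1 :> R by rewrite invr_ge0.
have h1 : 2^-1 <= 1 :> R by lra.
move=> /(_ (introT andP (conj h0 h1))); rewrite (_ : 1 - 2^-1 = 2^-1 :> R); last by lra.
rewrite !scalerA mulVf// !scale1r !J_scale//.
by rewrite !muleA -!EFinM mulVf// !mul1e.
Qed.

Lemma J_sum s (I : eqType) (r : seq I) (c : I -> R) (v : I -> X) :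
  S s -> (forall i, i \in r -> 0 <= c i) ->
  (J (\sum_(i <- r) c i *: v i)%R s <= \sum_(i <- r) (c i)%:E * J (v i) s)%E.
Proof.
move=> Ss; elim: r => [|i r IH] c0; first by rewrite !big_nil J0.
rewrite !big_cons (le_trans (J_add _ _ Ss))// J_scale//; last first.
  by apply: c0; rewrite mem_head.
by rewrite leeD2l// IH// => j jr; apply: c0; rewrite inE jr orbT.
Qed.

Lemma sublevel_ballP s v : sublevel_ball J alpha s v <-> (J v s <= alpha^-1%:E)%E.
Proof.
rewrite /sublevel_ball/= -[X in (_ <= X)%E <-> _](_ : alpha%:E * (alpha^-1)%:E = 1)%E.
  by rewrite lee_pmul2l.
by rewrite -EFinM divff// gt_eqF.
Qed.

Lemma atom_fin q : atoms q -> J q.1 q.2 \is a fin_num.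
Proof.
move=> [Ss /sublevel_ballP]; move: (hJ q.1 Ss).
by case: (J _ _).
Qed.

Lemma atom_cost q : atoms q -> alpha * fine (J q.1 q.2) <= 1.
Proof.
move=> aq; have [_] := aq; rewrite /sublevel_ball/= -(fineK (atom_fin aq)).
by rewrite -EFinM lee_fin.
Qed.

Lemma norm_le_J : exists2 C : R, 0 < C & forall v s, S s ->
  (`|v|%:E <= (C * alpha)%:E * J v s)%E.
Proof.
have [C C0 CJ] := H3; exists (C / alpha); first by rewrite divr_gt0.
by move=> v s Ss; rewrite divfK ?gt_eqF//; exact: CJ.
Qed.

Lemma atom0 s : S s -> atoms (0, s).
Proof. by move=> Ss; split => //=; rewrite /sublevel_ball/= J0// mule0 lee01. Qed.

Lemma sublevel_ball_convex s x y t : S s -> 0 <= t <= 1 ->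
  sublevel_ball J alpha s x -> sublevel_ball J alpha s y ->
  sublevel_ball J alpha s (t *: x + (1 - t) *: y).
Proof.
move=> Ss t01 /sublevel_ballP xs /sublevel_ballP ys; apply/sublevel_ballP.
have [_ /(_ x y t t01) + _] := H1 Ss; move=> /le_trans; apply.
have /andP[t0 t1] := t01.
apply: (@le_trans _ _ (t%:E * alpha^-1%:E + (1 - t)%:E * alpha^-1%:E)%E).
  by apply: leeD; apply: lee_wpmul2l => //; rewrite lee_fin// subr_ge0.
by rewrite -!EFinM -EFinD lee_fin -mulrDl addrC subrK mul1r.
Qed.

Lemma atoms_closed (u : nat -> X) v (t : nat -> E) s :
  weakstar_cvg pr u v -> (forall n, atoms (u n, t n)) -> S s ->
  t n @[n --> \oo] --> s -> atoms (v, s).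
Proof.
move=> uv ut Ss ts; split => //=; apply/sublevel_ballP.
rewrite (le_trans (H2 uv _ Ss ts))//; first by move=> n; have [] := ut n.
by apply: limn_einf_le => n; apply/sublevel_ballP; have [] := ut n.
Qed.

Lemma atoms_bounded : exists2 C : R, 0 < C & forall q, atoms q -> `|q.1| <= C.
Proof.
have [C C0 CJ] := H3; exists (C / alpha); first by rewrite divr_gt0.
move=> q [Ss /sublevel_ballP Jq]; rewrite -lee_fin (le_trans (CJ _ _ Ss))//.
by rewrite EFinM lee_wpmul2l// lee_fin ltW.
Qed.

Lemma atoms_seq_compact (q : nat -> X * E) : (forall n, atoms (q n)) ->
  exists (h : nat -> nat) (a : X * E),
    [/\ forall k, (k <= h k)%N, atoms a, weakstar_cvg pr (fst \o q \o h) a.1 &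
       (q (h k)).2 @[k --> \oo] --> a.2].
Proof.
move=> aq; have [C _ qC] := atoms_bounded.
have [] := @weakstar_seq_compact _ _ _ _ hpr _ hP _ S (fst \o q) (snd \o q) C hS.
- by move=> n; exact: qC.
- by move=> n /=; have [] := aq n.
move=> h [a [s [hk qa Ss qs]]]; exists h, (a, s); split => //.
apply: (@atoms_closed (fst \o q \o h) a (snd \o q \o h) s) => //.
by move=> n /=; rewrite -surjective_pairing.
Qed.

Definition face (p : Xs) (F : set (X * E)) : set (X * E) :=
  [set q | F q /\ forall y, F y -> pr p y.1 <= pr p q.1].

Definition atoms_seq_closed (F : set (X * E)) :=
  F `<=` atoms /\ forall (u : nat -> X) v (t : nat -> E) s,
  weakstar_cvg pr u v -> (forall n, F (u n, t n)) -> atoms (v, s) ->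
  t n @[n --> \oo] --> s -> F (v, s).

Lemma face_nonempty p F : atoms_seq_closed F -> F !=set0 -> face p F !=set0.
Proof.
move=> [FK Fc] [z Fz]; have [C C0 KC] := atoms_bounded.
pose V := [set pr p q.1 | q in F].
have supV : has_sup V.
  split; first by exists (pr p z.1), z.
  exists (`|p| * C) => _ [q Fq <-]; rewrite (le_trans (ler_norm _))//.
  by rewrite (le_trans (pairing_le hpr _ _))// ler_wpM2l// KC//; exact: FK.
have /choice[q qP] (n : nat) : exists q, F q /\ sup V - n.+1%:R^-1 < pr p q.1.
  have n0 : 0 < n.+1%:R^-1 :> R by rewrite invr_gt0.
  by have [_ [q Fq <-] qV] := sup_adherent n0 supV; exists q.
have [h [a [hk Ka qa qs]]] := atoms_seq_compact (fun n => FK _ (qP n).1).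
exists a; split.
  rewrite (surjective_pairing a); apply: (Fc (fst \o q \o h) a.1 (snd \o q \o h)) => //.
    by move=> n /=; rewrite -surjective_pairing; exact: (qP _).1.
move=> y Fy; apply: (@le_trans _ _ (sup V)).
  by apply: ub_le_sup; [exact: supV.2|exists y].
apply/ler_addgt0Pr => e e0.
apply/ler_addgt0Pr => e2 e20.
near \oo => k; have : `|pr p a.1 - pr p (q (h k)).1| < e2.
  by near: k; have /cvgrPdist_lt := qa p; exact.
have : (h k).+1%:R^-1 < e.
  suff : k.+1%:R^-1 < e.
    by apply: le_lt_trans; rewrite lef_pV2 ?posrE// ler_nat ltnS.
  by near: k; exact: (near_infty_natSinv_lt (PosNum e0)).
have [_] := qP (h k); rewrite distrC; move: ((h k).+1%:R^-1) => w.
move=> + + /ltr_normlW; lra.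
Unshelve. all: by end_near. Qed.

Lemma face_closed p F : atoms_seq_closed F -> atoms_seq_closed (face p F).
Proof.
move=> [FK Fc]; split; first by move=> q [/FK].
move=> u v t s uv Fut Ka ts; split.
  by apply: (Fc u v t s) => // n; exact: (Fut n).1.
move=> y Fy; apply: (cvg_ge_const (uv p)) => n; exact: (Fut n).2.
Qed.

(* Maximizing successively along the separating sequence [P] shrinks the face of
   maximizers to an extreme point. *)
Lemma argmax_extreme p : S !=set0 -> exists2 q, candidates S J alpha q &
  forall y, atoms y -> pr p y.1 <= pr p q.1.
Proof.
move=> [s0 Ss0]; have [a0 a0f] : face p atoms !=set0.
  apply: face_nonempty; last by exists (0, s0); exact: atom0.
  by split => // u v t s.
have [[Sa0 _] _] := a0f.
(* Extremality is meant within one ball, so the point of [S] is frozen before the faces are cut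
   further. *)
pose G0 := [set q | q.2 = a0.2 /\ face p atoms q].
pose G := fix G n := if n is m.+1 then face (P m) (G m) else G0.
have Gc n : atoms_seq_closed (G n).
  elim: n => [|n IH]; last exact: face_closed.
  split; first by move=> q [_ []].
  move=> u v t s uv Gut Ka ts; split => /=.
    apply: (cvg_unique _ ts) => //; rewrite (_ : t = cst a0.2).
      exact: cvg_cst.
    by apply/funext => n; exact: (Gut n).1.
  split => // y Ky; apply: (cvg_ge_const (uv p)) => n.
  by have [_ []] := Gut n => _; apply.
have G0' n : G n !=set0.
  elim: n => [|n IH]; first by exists a0.
  exact: face_nonempty.
have GS n : G n.+1 `<=` G n by move=> q [].
have Gle m n : (m <= n)%N -> G n `<=` G m.
  elim: n => [|n IH]; first by rewrite leqn0 => /eqP->.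
  by rewrite leq_eqVlt ltnS => /predU1P[->//|/IH]; apply: subset_trans.
have /choice[x xG] n : exists q, G n q by have [q] := G0' n; exists q.
have [h [a [hk Ka xa xs]]] := atoms_seq_compact (fun n => (Gc n).1 _ (xG n)).
(* Dropping the first [m] terms leaves a sequence inside the closed set [G m]. *)
have Ga m : G m a.
  rewrite (surjective_pairing a).
  apply: ((Gc m).2 (fun k => (x (h (k + m)%N)).1) a.1
           (fun k => (x (h (k + m)%N)).2)) => //.
  - by move=> q; have := xa q; rewrite -(cvg_shiftn m).
  - move=> n; rewrite -surjective_pairing; apply: (@Gle _ (h (n + m)%N)) => //.
    by rewrite (leq_trans _ (hk _))// leq_addl.
  - by move: xs; rewrite -(cvg_shiftn m).
have [as0 [_ amax]] := Ga 0%N.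
exists a => //; split; first by rewrite as0.
split; first by case: Ka.
move=> y z t Ky Kz t01 aE.
have Kys : atoms (y, a.2) by split; first by case: Ka.
have Kzs : atoms (z, a.2) by split; first by case: Ka.
have aq q : pr q a.1 = t * pr q y + (1 - t) * pr q z.
  by rewrite aE linearDr/= !linearZr_LR.
(* A form that attains its maximum inside a segment attains it at both ends, so both ends stay in
   every face and agree with [a.1] under each [P n]. *)
have Gyz n : G n (y, a.2) /\ G n (z, a.2).
  elim: n => [|n [Gy Gz]].
    have [py pz] := segment_max t01 (amax _ Kys) (amax _ Kzs) (aq p).
    by split; split => //=; split => //= w Kw; rewrite (py, pz); exact: amax.
  have [_ am] := Ga n.+1.
  have [py pz] := segment_max t01 (am _ Gy) (am _ Gz) (aq (P n)).
  by split; split => //= w Kw; rewrite (py, pz); exact: am.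
have Pyz n : pr (P n) y = pr (P n) a.1 /\ pr (P n) z = pr (P n) a.1.
  have [_ am] := Ga n.+1; have [Gy Gz] := Gyz n.
  exact: segment_max t01 (am _ Gy) (am _ Gz) (aq (P n)).
by split; apply: (eq_norming hP) => n; have [] := Pyz n.
Qed.

Lemma candidates_atoms : candidates S J alpha `<=` atoms.
Proof. by move=> q [Sq []]. Qed.

(** * The data term: expansion, tangent bound and duality *)

Context {Y : completeNormedModType R} (ip : {dot Y for idfun}).
Context (hip : induces_norm ip) (A : {linear X -> Y}) (Astar : {linear Y -> Xs}).
Context (hAstar : continuous Astar).
Context (hA : forall (y : Y) (v : X), pr (Astar y) v = ip y (A v)) (f : Y).
Context (hS0 : S !=set0).

Local Notation measE := {measure set (borelType E) -> \bar R}.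

Lemma ipC y z : ip y z = ip z y.
Proof. by rewrite hermC/= expr0 mul1r. Qed.

Lemma sqr_normD y z : `|y + z| ^+ 2 = `|y| ^+ 2 + 2 * ip y z + `|z| ^+ 2.
Proof.
rewrite !hip linearDr/= !linearDl/= (ipC z y).
by move: (ip y y) (ip y z) (ip z z) => a b c; ring.
Qed.

(** From [|A v|^2 = pr (Astar (A v)) v] and the continuity of [Astar]. *)
Lemma operator_bounded : exists2 L : R, 0 < L & forall v : X, `|A v| <= L * `|v|.
Proof.
have /continuous_linear_bounded/linear_boundedP[r [_ rP]] := @hAstar (0 : Y).
pose L := `|r| + 1; have L0 : 0 < L by rewrite ltr_wpDl.
have AsL y : `|Astar y| <= L * `|y|.
  by apply: rP; rewrite /L (le_lt_trans (ler_norm _))// ltrDl.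
exists L => // v; have [->|Av0] := eqVneq (A v) 0.
  by rewrite normr0 mulr_ge0// ltW.
have Av : 0 < `|A v| by rewrite normr_gt0.
rewrite -(ler_pM2l Av) -expr2 hip -hA (le_trans (ler_norm _))//.
rewrite (le_trans (pairing_le hpr _ _))// mulrCA mulrA.
by rewrite ler_wpM2r.
Qed.

Definition misfit (x : X) : R := 2^-1 * `|A x - f| ^+ 2.

(** The negative gradient of [misfit]; at an iterate it is the dual variable of the algorithm. *)
Definition dual_certificate (x : X) : Xs := - Astar (A x - f).

Lemma misfitD x z t : misfit (x + t *: z) =
  misfit x - t * pr (dual_certificate x) z + t ^+ 2 / 2 * `|A z| ^+ 2.
Proof.
rewrite /misfit /dual_certificate linearD/= addrAC sqr_normD linearZ/=.
rewrite linearZr_LR/= -hA linearNl/= normrZ exprMn real_normK ?num_real//.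
by move: (`|_| ^+ 2) (`|_| ^+ 2) (pr _ _) => a b c; field.
Qed.

Lemma misfit_lower x v : misfit x + pr (dual_certificate x) x -
  pr (dual_certificate x) v <= misfit v.
Proof.
have -> : v = x + 1 *: (v - x) by rewrite scale1r addrCA subrr addr0.
rewrite misfitD mul1r expr1n scale1r addrCA subrr addr0 linearBr/=.
have : 0 <= `|A (v - x)| ^+ 2 by rewrite exprn_ge0.
move: (`|_| ^+ 2) => a; lra.
Qed.

Lemma misfit_ge0 x : 0 <= misfit x.
Proof. by rewrite mulr_ge0 ?invr_ge0 ?exprn_ge0. Qed.

(** [g] and [gam] are the costs of [x] and of the competitor [v]. In the linearized objective a mass
    [T] on [q] contributes [(1 - m) * T], which is minimal over [[0, T0]] at the end point selected
    by the sign of [m - 1]; it thus beats the contribution of [v]. *)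
Lemma conditional_gradient_step (x q v : X) (g T0 gam t : R) :
  let m := pr (dual_certificate x) q in
  0 <= gam <= T0 -> 0 <= t -> pr (dual_certificate x) v <= m * gam ->
  forall T, T = (if 1 <= m then T0 else 0) ->
  misfit (x + t *: (T *: q - x)) + (g + t * (T - g)) <=
  (misfit x + g) - t * (misfit x + g - (misfit v + gam))
   + t ^+ 2 / 2 * `|A (T *: q - x)| ^+ 2.
Proof.
move=> m /andP[gam0 gamT] t0 pv T TE.
rewrite misfitD linearBr/= linearZr_LR/= -/m.
have := misfit_lower x v.
have mT : (m - 1) * gam <= (m - 1) * T.
  rewrite TE; case: (leP 1 m) => m1; first by rewrite ler_wpM2l// subr_ge0.
  by rewrite mulr0 mulr_le0_ge0// subr_le0 ltW.
set px := pr _ x in pv *; set pv' := pr _ v in pv *.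
move: (`|_| ^+ 2) (misfit x) (misfit v) => a b c low.
have key : b + g - (c + gam) <= g - px + (m - 1) * T by lra.
have : t * (b + g - (c + gam)) <= t * (g - px + (m - 1) * T).
  by rewrite ler_wpM2l.
move: (t * _) (t ^+ 2 / 2 * a) => z w; lra.
Qed.

(** Rescale [x] to an atom by homogeneity. If [J x s = 0] this is impossible, but then (H3) forces
    [x = 0]. *)
Lemma J_pairing (p : Xs) (m : R) : 0 < m ->
  (forall y, atoms y -> pr p y.1 <= m) ->
  forall x s, S s -> ((pr ((m * alpha)^-1 *: p) x)%:E <= J x s)%E.
Proof.
move=> m0 pm x s Ss; have ma : 0 < m * alpha by rewrite mulr_gt0.
case Jx : (J x s) (hJ x Ss) => [j| |] // j0; last by rewrite leey.
rewrite !lee_fin in j0 *; rewrite linearZl_LR/=; rewrite ler_pdivrMl//.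
have [j00|jn0] := eqVneq j 0.
  have [C _ CJ] := H3; have := CJ x s Ss; rewrite Jx j00 mule0 lee_fin normr_le0.
  by move=> /eqP->; rewrite linear0r mulr0.
have jp : 0 < j by rewrite lt0r jn0.
have aj : 0 < alpha * j by rewrite mulr_gt0.
have : atoms ((alpha * j)^-1 *: x, s).
  split => //=; rewrite /sublevel_ball/= J_scale ?invr_ge0 ?(ltW aj)// Jx.
  by rewrite -!EFinM lee_fin mulrCA mulVf// gt_eqF.
by move=> /pm/=; rewrite linearZr_LR/= ler_pdivrMl// mulrC mulrA.
Qed.

Lemma tikhonov_fin (w : X * measE) : radon_plus S w.2 ->
  (tikhonov S J A f alpha w < +oo)%E ->
  exists2 gam : R, 0 <= gam &
    tikhonov S J A f alpha w = (misfit w.1 + gam)%:E /\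
    forall p m, 0 <= m -> (forall y, atoms y -> pr p y.1 <= m) ->
      pr p w.1 <= m * gam.
Proof.
move=> [sfin _ _]; have I0 := infconv_ge0 w.1 w.2 hJ.
rewrite /tikhonov -/(misfit _).
case Iw : (infconv S J w.1 w.2) I0 => [r| |] I0 //; last first.
  by rewrite gt0_muley// lte_fin.
move=> _; exists (alpha * r); first by rewrite mulr_ge0// ltW.
split; first by rewrite EFinD EFinM.
move=> p m m0 pm.
have Soo : (w.2 S < +oo)%E.
  by have := sfin S (compact_borel hS); rewrite ge0_fin_numE.
(* The bound divides by its constant while [m] may be 0, so it is proved for every larger [m'] and
   the excess is sent to 0. *)
have key m' : m < m' -> pr p w.1 <= m' * (alpha * r).
  move=> mm'; have m'0 : 0 < m' by exact: le_lt_trans mm'.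
  have : ((pr ((m' * alpha)^-1 *: p) w.1)%:E <= infconv S J w.1 w.2)%E.
    apply: (infconv_ge hpr hS) => //; apply: J_pairing => // y Ky.
    by rewrite (le_trans (pm _ Ky))// ltW.
  by rewrite Iw lee_fin linearZl_LR/= ler_pdivrMl ?mulr_gt0// mulrA.
have ar0 : 0 <= alpha * r by rewrite mulr_ge0// ltW.
apply/ler_addgt0Pr => e e0.
have d0 : 0 < e / (alpha * r + 1) by rewrite divr_gt0// ltr_wpDl.
have := key (m + e / (alpha * r + 1)); rewrite ltrDl => /(_ d0) /le_trans; apply.
rewrite mulrDl lerD2l mulrAC ler_pdivrMr ?ltr_wpDl//.
by rewrite ler_pM2l// lerDl.
Qed.

(** * Descent of the algorithm *)

Local Notation state := (seq ((X * E) * R)).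

Definition cost (a : state) : R :=
  \sum_(q <- a) q.2 * (alpha * fine (J q.1.1 q.1.2)).

Definition objective (a : state) : R := misfit (iterate_v a) + cost a.

Lemma A_iterate (a : state) : A (iterate_v a) = \sum_(q <- a) q.2 *: A q.1.1.
Proof. by rewrite /iterate_v linear_sum; apply: eq_bigr => q _; rewrite linearZ. Qed.

Lemma weight_objectiveE (a : state) : (forall q, q \in a -> atoms q.1) ->
  weight_objective A J alpha f a = (objective a)%:E.
Proof.
move=> aK; rewrite /weight_objective -A_iterate -/(misfit _) /objective EFinD.
congr (_ + _)%E; rewrite /cost.
have -> : (\sum_(q <- a) q.2%:E * J q.1.1 q.1.2 =
    (\sum_(q <- a) q.2 * fine (J q.1.1 q.1.2))%:E)%E.
  rewrite -sumEFin big_seq [RHS]big_seq; apply: eq_bigr => q qa.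
  by rewrite EFinM fineK// atom_fin//; exact: aK.
rewrite -EFinM mulr_sumr; congr EFin; apply: eq_bigr => q _.
by rewrite mulrCA.
Qed.

Lemma iterate_v_rcons (a : state) q : iterate_v (rcons a q) = iterate_v a + q.2 *: q.1.1.
Proof. by rewrite /iterate_v -cats1 big_cat big_seq1. Qed.

Lemma cost_rcons (a : state) q :
  cost (rcons a q) = cost a + q.2 * (alpha * fine (J q.1.1 q.1.2)).
Proof. by rewrite /cost -cats1 big_cat big_seq1. Qed.

Definition rescale (c : R) (a : state) : state := [seq (q.1, c * q.2) | q <- a].

Lemma iterate_v_rescale c (a : state) : iterate_v (rescale c a) = c *: iterate_v a.
Proof.
rewrite /iterate_v big_map scaler_sumr; apply: eq_bigr => q _.
by rewrite scalerA.
Qed.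

Lemma cost_rescale c (a : state) : cost (rescale c a) = c * cost a.
Proof.
rewrite /cost big_map mulr_sumr; apply: eq_bigr => q _ /=.
by rewrite -mulrA.
Qed.

Lemma weightings_rescale c atms (a : state) : 0 <= c ->
  weightings atms a -> weightings atms (rescale c a).
Proof.
move=> c0 [aE a0]; split; first by rewrite /unzip1 -map_comp.
by move=> q /mapP[r ra ->] /=; rewrite mulr_ge0// a0.
Qed.

Lemma weightings_rcons atms (a : state) q : 0 <= q.2 ->
  weightings atms a -> weightings (rcons atms q.1) (rcons a q).
Proof.
move=> q0 [aE a0]; split; first by rewrite /unzip1 map_rcons -/(unzip1 a) aE.
by move=> r; rewrite mem_rcons inE => /predU1P[->//|]; exact: a0.
Qed.

Lemma weightings_atoms atms (a : state) : (forall q, q \in atms -> atoms q) ->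
  weightings atms a -> forall q, q \in a -> atoms q.1.
Proof. by move=> Katms [aE _] q qa; apply: Katms; rewrite -aE map_f. Qed.

Lemma iterate_v_perm (a b : state) : perm_eq a b -> iterate_v a = iterate_v b.
Proof. exact: perm_big. Qed.

Lemma cost_perm (a b : state) : perm_eq a b -> cost a = cost b.
Proof. exact: perm_big. Qed.

Lemma iterate_v_filter (b : state) : (forall q, q \in b -> 0 <= q.2) ->
  iterate_v [seq w <- b | 0 < w.2] = iterate_v b.
Proof.
move=> b0; rewrite /iterate_v big_filter big_mkcond big_seq [RHS]big_seq.
apply: eq_bigr => q qb; case: ltP => // q0.
by rewrite (_ : q.2 = 0) ?scale0r//; apply/eqP; rewrite eq_le q0 b0.
Qed.

Lemma cost_filter (b : state) : (forall q, q \in b -> 0 <= q.2) ->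
  cost [seq w <- b | 0 < w.2] = cost b.
Proof.
move=> b0; rewrite /cost big_filter big_mkcond big_seq [RHS]big_seq.
apply: eq_bigr => q qb; case: ltP => // q0.
by rewrite (_ : q.2 = 0) ?mul0r//; apply/eqP; rewrite eq_le q0 b0.
Qed.

Local Notation iterates := (is_iterate pr A Astar S J alpha f).
Local Notation stepped := (step pr A Astar S J alpha f).

(* A step is used only through the atom it inserts and the optimality of its
   weights; zero weights dropped by the algorithm do not change the iterate. *)
Lemma step_optimal k (a a' : state) : (forall q, q \in a -> atoms q.1) ->
  stepped k a a' -> exists (q : X * E) (b : state),
  [/\ candidates S J alpha q /\ (forall y, atoms y ->
        pr (dual_certificate (iterate_v a)) y.1 <=
        pr (dual_certificate (iterate_v a)) q.1),
      weightings (rcons (unzip1 a) q) b,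
      iterate_v a' = iterate_v b /\ cost a' = cost b,
      (forall w, w \in a' -> w \in b /\ 0 < w.2) &
      forall c, weightings (rcons (unzip1 a) q) c -> objective b <= objective c].
Proof.
move=> aK [q [[qc qmax] _ _] [b [bw bmin] a'b]].
(* The insertion competes with extreme points only. Since one of them, [e], maximizes over all
   atoms, the inserted atom does too. *)
have [e ec emax] := argmax_extreme (dual_certificate (iterate_v a)) hS0.
have Katms : forall y, y \in rcons (unzip1 a) q -> atoms y.
  move=> y; rewrite mem_rcons inE => /predU1P[->|/mapP[r ra ->]].
    exact: candidates_atoms qc.
  exact: aK.
have b0 := bw.2.
exists q, b; split => //.
- split => // y Ky; apply: (le_trans (emax _ Ky)); exact: qmax.
- by rewrite (iterate_v_perm a'b) (cost_perm a'b) iterate_v_filter// cost_filter.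
- by move=> w; rewrite (perm_mem a'b) mem_filter => /andP[].
- move=> c cw; have := bmin _ cw.
  by rewrite !weight_objectiveE//; exact: weightings_atoms Katms _.
Qed.

Lemma iterates_atoms k a : iterates k a ->
  forall q, q \in a -> atoms q.1 /\ 0 < q.2.
Proof.
elim=> [//|{}k {}a a' _ IH st].
have [q [b [[qc _] bw _ a'b _]]] := step_optimal (fun q qa => (IH q qa).1) st.
move=> w /a'b[wb w0]; split => //.
apply: (weightings_atoms _ bw) wb => y.
rewrite mem_rcons inE => /predU1P[->|/mapP[r ra ->]].
  exact: candidates_atoms qc.
by have [] := IH r ra.
Qed.

Lemma unzip1_weighting (a : state) : (forall q, q \in a -> atoms q.1 /\ 0 < q.2) ->
  weightings (unzip1 a) a.
Proof. by move=> aK; split => // q /aK[_ /ltW]. Qed.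

(** A conditional gradient step is an admissible choice of weights: scale the old ones by [1 - t]
    and give the new atom [t * T]. The inequality comes from atoms of cost below 1. *)
Lemma mix_weighting (a : state) (q : X * E) (t T : R) :
  (forall w, w \in a -> atoms w.1 /\ 0 < w.2) -> atoms q -> 0 <= t <= 1 ->
  0 <= T -> exists2 c, weightings (rcons (unzip1 a) q) c &
    objective c <= misfit (iterate_v a + t *: (T *: q.1 - iterate_v a)) +
                   (cost a + t * (T - cost a)).
Proof.
move=> aK Kq /andP[t0 t1] T0; exists (rcons (rescale (1 - t) a) (q, t * T)).
  apply: (@weightings_rcons _ _ (q, t * T)); first by rewrite mulr_ge0.
  by apply: weightings_rescale; [rewrite subr_ge0|exact: unzip1_weighting].
rewrite /objective iterate_v_rcons cost_rcons iterate_v_rescale cost_rescale/=.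
have -> : (1 - t) *: iterate_v a + (t * T) *: q.1 =
    iterate_v a + t *: (T *: q.1 - iterate_v a).
  by rewrite scalerBl scale1r scalerBr scalerA -addrA [- _ + _]addrC.
rewrite lerD2l.
have -> : cost a + t * (T - cost a) = (1 - t) * cost a + t * T by ring.
by rewrite lerD2l ler_piMr ?atom_cost// mulr_ge0.
Qed.

Lemma norm_iterate : exists2 C : R, 0 < C & (forall y, atoms y -> `|y.1| <= C) /\
  forall a, (forall w, w \in a -> atoms w.1 /\ 0 < w.2) ->
    `|iterate_v a| <= C * cost a.
Proof.
have [C C0 CJ] := norm_le_J; exists C => //.
have key y : atoms y -> `|y.1| <= C * (alpha * fine (J y.1 y.2)).
  move=> Ky; have [Sy _] := Ky; have := CJ y.1 y.2 Sy.
  by rewrite -{1}(fineK (atom_fin Ky)) -EFinM lee_fin mulrA.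
split.
  move=> y Ky; apply: (le_trans (key y Ky)).
  by rewrite ler_piMr ?atom_cost// ltW.
move=> a aK; rewrite /iterate_v /cost mulr_sumr.
apply: (le_trans (ler_norm_sum _ _ _)); rewrite big_seq [leRHS]big_seq.
apply: ler_sum => q /aK[Kq q0]; rewrite normrZ gtr0_norm// mulrCA.
by rewrite ler_pM2l// key.
Qed.

Lemma iterates_objective_le k a : iterates k a -> objective a <= misfit 0.
Proof.
elim=> [|{}k {}a a' it IH st].
  by rewrite /objective /cost /iterate_v !big_nil addr0.
have aK := iterates_atoms it.
have [q [b [[qc _] _ [va' ca'] _ bmin]]] :=
  step_optimal (fun q qa => (aK q qa).1) st.
(* With [t = 0] the old weights are kept and the inserted atom gets weight 0. *)
have [|c cw cle] := @mix_weighting a q 0 0 aK (candidates_atoms qc) _ (lexx _).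
  by rewrite lexx ler01.
rewrite /objective va' ca'; apply: le_trans (bmin _ cw) _.
by apply: le_trans cle _; rewrite scale0r mul0r !addr0.
Qed.

Lemma iterates_cost_le k a : iterates k a -> cost a <= misfit 0.
Proof.
move=> /iterates_objective_le; apply: le_trans.
by rewrite lerDr misfit_ge0.
Qed.

(* The dual form of [v] lying in [gam] times the closed convex hull of the atoms. *)
Definition dominated (v : X) (gam : R) := forall p m, 0 <= m ->
  (forall y, atoms y -> pr p y.1 <= m) -> pr p v <= m * gam.

Lemma argmax_ge0 p (q : X * E) : (forall y, atoms y -> pr p y.1 <= pr p q.1) ->
  0 <= pr p q.1.
Proof.
by move=> qmax; have [s Ss] := hS0; have := qmax _ (atom0 Ss); rewrite linear0r.
Qed.

Lemma iterates_descent : exists2 D : R, 0 <= D &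
  forall v gam, 0 <= gam <= misfit 0 -> dominated v gam ->
  forall k a a', iterates k a -> stepped k a a' -> forall t, 0 <= t <= 1 ->
    objective a' - (misfit v + gam) <=
      (1 - t) * (objective a - (misfit v + gam)) + t ^+ 2 / 2 * D.
Proof.
have [L L0 AL] := operator_bounded; have [C C0 [KC aC]] := norm_iterate.
(* Both the iterate and the target [T *: q.1] have norm at most [C * misfit 0], and [L] bounds
   [A]. *)
exists ((L * (C * misfit 0 *+ 2)) ^+ 2); first exact: sqr_ge0.
move=> v gam gamT vgam k a a' it st t t01; have aK := iterates_atoms it.
have [q [b [[qc qmax] _ [va' ca'] _ bmin]]] :=
  step_optimal (fun q qa => (aK q qa).1) st.
have Kq := candidates_atoms qc.
have q0 := argmax_ge0 qmax.
set m := pr _ q.1 in q0; pose T := if 1 <= m then misfit 0 else 0.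
have T01 : 0 <= T <= misfit 0.
  by rewrite /T; case: ifP => _; rewrite ?lexx misfit_ge0.
have /andP[T0 T1] := T01; have /andP[t0 t1] := t01.
have [c cw cle] := mix_weighting aK Kq t01 T0.
have pv : pr (dual_certificate (iterate_v a)) v <= m * gam by exact: vgam.
have stp := conditional_gradient_step (cost a) gamT t0 pv (erefl T).
have bound : `|A (T *: q.1 - iterate_v a)| ^+ 2 <= (L * (C * misfit 0 *+ 2)) ^+ 2.
  rewrite ler_pXn2r ?nnegrE//; last first.
    by rewrite mulr_ge0 ?(ltW L0)// mulrn_wge0// mulr_ge0 ?misfit_ge0 ?(ltW C0).
  rewrite (le_trans (AL _))// ler_pM2l// (le_trans (ler_normB _ _))// mulr2n.
  rewrite lerD//.
    by rewrite normrZ ger0_norm// mulrC ler_pM// KC.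
  by rewrite (le_trans (aC _ aK))// ler_pM2l// (iterates_cost_le it).
have t2 : 0 <= t ^+ 2 / 2 by rewrite mulr_ge0 ?exprn_ge0// invr_ge0.
have := ler_wpM2l t2 bound; have := bmin _ cw.
have -> : objective a' = objective b by rewrite /objective va' ca'.
rewrite -/(objective a) in stp; move: cle stp.
set x1 := misfit _ + _; set D := (_ * _) ^+ 2; set D' := `|_| ^+ 2.
move: (t ^+ 2 / 2 * D) (t ^+ 2 / 2 * D') => z w; lra.
Qed.

Lemma iterates_rate : exists2 C : R, 0 < C &
  forall v gam, 0 <= gam <= misfit 0 -> dominated v gam ->
  forall k a, iterates k a -> objective a - (misfit v + gam) <= C / k.+1%:R.
Proof.
have [D D0 descent] := iterates_descent.
(* [2 * D] feeds the induction, [misfit 0] covers the initial iterate, and 1 ensures positivity. *)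
exists (2 * D + misfit 0 + 1).
  by rewrite ltr_wpDl// addr_ge0 ?misfit_ge0// mulr_ge0.
move=> v gam gamT vgam k a; elim=> [|{}k {}a a' it IH st].
  rewrite invr1 mulr1 /objective /cost /iterate_v !big_nil.
  have /andP[g0 _] := gamT; have := misfit_ge0 v; lra.
apply: (rate_step D0 _ _ IH); first by have := misfit_ge0 0; lra.
by move=> t t01; exact: descent st t t01.
Qed.

(** With [x] the iterate and [p] its certificate, optimality of the weights gives
    [cost a <= pr p x], and stopping gives [pr p <= 1] on all atoms; the tangent bound for [misfit]
    at [x] turns these into global optimality. *)
Lemma terminates_minimal k a v gam : terminates_at pr A Astar S J alpha f k a ->
  0 <= gam -> dominated v gam -> objective a <= misfit v + gam.
Proof.
move=> [it [q [qc qmax] [k1 stopq]]] gam0 vgam; have aK := iterates_atoms it.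
have [e ec emax] := argmax_extreme (dual_certificate (iterate_v a)) hS0.
have qmax' y : atoms y -> pr (dual_certificate (iterate_v a)) y.1 <=
    pr (dual_certificate (iterate_v a)) q.1.
  by move=> Ky; apply: (le_trans (emax _ Ky)); exact: qmax.
(* Stopping requires [k >= 1], so there is a last step whose optimal weights can be perturbed. *)
case: it k1 stopq aK {e ec emax} qc qmax qmax' => [//|{}k a0 {}a it st] _.
set x := iterate_v a => stopq aK qc _ qmax.
have a0K := iterates_atoms it.
have [q0 [b [_ bw [va cb] ab bmin]]] := step_optimal (fun w wa => (a0K w wa).1) st.
have objab : objective a = objective b by rewrite /objective va cb.
have cpx : cost a <= pr (dual_certificate x) x.
  (* Perturbation: all weights are scaled by [1 - t]. *)
  rewrite -subr_ge0; apply: (@le0_of_quadratic _ _ (2^-1 * `|A x| ^+ 2)) => t /andP[t0 t1].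
  have cw : weightings (rcons (unzip1 a0) q0) (rescale (1 - t) b).
    by apply: weightings_rescale => //; rewrite subr_ge0.
  have := bmin _ cw; rewrite -objab /objective iterate_v_rescale cost_rescale.
  rewrite -va -cb -/x [(1 - t) *: x](_ : _ = x + (- t) *: x); last first.
    by rewrite scalerBl scale1r scaleNr.
  rewrite misfitD sqrrN; move: (`|A x| ^+ 2) => n.
  by move=> h; have -> : t ^+ 2 * (2^-1 * n) = t ^+ 2 / 2 * n; [ring|lra].
have pq1 : pr (dual_certificate x) q.1 <= 1.
  case: stopq => [//|/mapP[w wa qw]].
  have Kq := candidates_atoms qc; apply: le_trans _ (atom_cost Kq).
  (* The proposed atom is already active; its weight is raised by [t], so its pairing cannot exceed
     its cost, which is at most 1. *)
  rewrite -subr_ge0; apply: (@le0_of_quadratic _ _ (2^-1 * `|A q.1| ^+ 2)) => t /andP[t0 t1].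
  have [wb w0] := ab _ wa; case/splitPr: wb bmin bw va cb objab => s1 s2 bmin bw va cb objab.
  have cw : weightings (rcons (unzip1 a0) q0) (s1 ++ (q, w.2 + t) :: s2).
    split; first by rewrite -bw.1 /unzip1 !map_cat/= qw.
    move=> y; rewrite mem_cat inE => /or3P[ys|/eqP->|ys].
    - by apply: bw.2; rewrite mem_cat ys.
    - by apply: addr_ge0; exact: ltW.
    - by apply: bw.2; rewrite mem_cat inE ys !orbT.
  have := bmin _ cw; rewrite -objab /objective.
  have -> : iterate_v (s1 ++ (q, w.2 + t) :: s2) = x + t *: q.1.
    rewrite /x va /iterate_v !big_cat !big_cons/= scalerDl qw.
    by rewrite -!addrA; congr (_ + (_ + _)); rewrite addrC.
  have -> : cost (s1 ++ (q, w.2 + t) :: s2) =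
      cost a + t * (alpha * fine (J q.1 q.2)).
    rewrite cb /cost !big_cat !big_cons/= qw mulrDl.
    by rewrite -!addrA; congr (_ + (_ + _)); rewrite addrC.
  rewrite misfitD -/x; move: (`|A q.1| ^+ 2) => n.
  by move=> h; have -> : t ^+ 2 * (2^-1 * n) = t ^+ 2 / 2 * n; [ring|lra].
have pv := vgam _ _ (argmax_ge0 qmax) qmax.
have := misfit_lower x v; rewrite /objective -/x.
have : pr (dual_certificate x) q.1 * gam <= 1 * gam by rewrite ler_wpM2r.
lra.
Qed.

(** * The measure attached to an iterate *)

Section iterate_measure.
Variable a : state.
Hypothesis aK : forall w, w \in a -> atoms w.1 /\ 0 < w.2.

Let supp := undup [seq q.1.2 | q <- a].
Let w (s : E) : X := \sum_(q <- a | q.1.2 == s) q.2 *: q.1.1.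
(** The polar density of the vector measure with mass [w s] at [s], relative to its variation. Where
    [w s = 0] it is 0, because the inverse of 0 is 0. *)
Let u (s : E) : X := if s \in supp then `|w s|^-1 *: w s else 0.
Let hE : accessible_space E := hausdorff_accessible (@norm_hausdorff R E).

Let suppS s : s \in supp -> S s.
Proof. by rewrite mem_undup => /mapP[q /aK[[Sq _] _] ->]. Qed.

Let wu s : `|w s| *: u s = w s.
Proof.
rewrite /u; case: ifPn => [_|ns].
  have [->|w0] := eqVneq (w s) 0; first by rewrite !scaler0.
  by rewrite scalerA divff ?scale1r// normr_eq0.
rewrite scaler0 /w big_seq_cond big1// => q /andP[qa /eqP qs].
by case/negP: ns; rewrite mem_undup -qs; apply/mapP; exists q.
Qed.

Let u_le1 s : `|u s| <= 1.
Proof.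
rewrite /u; case: ifP => _; last by rewrite normr0.
rewrite normrZ normfV normr_id; have [->|w0] := eqVneq (w s) 0.
  by rewrite normr0 mulr0.
by rewrite mulVf// normr_eq0.
Qed.

Let sum_supp (V : nmodType) (h : (X * E) * R -> V) :
  \sum_(s <- supp) \sum_(q <- a | q.1.2 == s) h q = \sum_(q <- a) h q.
Proof.
under eq_bigr do rewrite big_mkcond.
rewrite exchange_big/= big_seq [RHS]big_seq; apply: eq_bigr => q qa.
have qs : q.1.2 \in supp by rewrite mem_undup; apply/mapP; exists q.
rewrite (bigD1_seq q.1.2)//= ?undup_uniq// eqxx big1 ?addr0// => s sq.
by rewrite eq_sym (negbTE sq).
Qed.

Let iterate_sigmaE (B : set (borelType E)) : measurable B ->
  iterate_sigma a B = (\sum_(s <- supp) `|w s| * (s \in B)%:R)%:E.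
Proof.
move=> mB; rewrite -sumEFin (big_nth 0) big_mkord.
by apply: eq_bigr => i _; rewrite EFinM.
Qed.

Lemma iterate_sigma_radon : radon_plus S (iterate_sigma a).
Proof.
have mS := compact_borel hS; apply: radon_plus_finite => //.
  rewrite iterate_sigmaE; last exact: measurableC.
  congr EFin; rewrite big_seq big1// => s ss.
  by rewrite memNset ?mulr0//= => /(_ (suppS ss)).
by rewrite iterate_sigmaE// ltry.
Qed.

Let u_simple : simple_function (u : borelType E -> X).
Proof.
split.
  apply: (@measurable_fun_finite_support _ _ (borelType X) supp 0 u hE).
  by move=> x xs; rewrite /u (negbTE xs).
apply: (@sub_finite_set _ _ ((u @` [set` supp]) `|` [set 0])).
  move=> _ [s _ <-]; have [ss|ss] := boolP (s \in supp); first by left; exists s.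
  by right; rewrite /u (negbTE ss).
by rewrite finite_setU; split; [apply: finite_image; exact: finite_seq|exact: finite_set1].
Qed.

Let simple_integral_u : simple_integral (iterate_sigma a) S u = iterate_v a.
Proof.
rewrite /simple_integral (fsbig_finite _ _ u_simple.2).
transitivity (\sum_(x <- finmap.enum_fset (fset_set (range u)))
    \sum_(s <- supp) (`|w s| * (u s == x)%:R) *: x).
  apply: eq_bigr => x _; rewrite -scaler_suml iterate_sigmaE/=; last first.
    apply: measurableI; first exact: compact_borel hS.
    exact: simple_function_preimage.
  congr (_ *: _); rewrite big_seq [RHS]big_seq; apply: eq_bigr => s ss.
  congr (_ * (nat_of_bool _)%:R); apply/idP/eqP => [/set_mem[]//|ux].
  by apply/mem_set; split => //; exact: suppS.
rewrite exchange_big/=; transitivity (\sum_(s <- supp) w s); last exact: sum_supp.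
apply: eq_bigr => s _; rewrite (bigD1_seq (u s))/=; last 2 first.
  by rewrite in_fset_set ?inE; [exists s|exact: u_simple.2].
  exact: finmap.fset_uniq.
rewrite eqxx mulr1 wu big1 ?addr0// => x xs.
by rewrite eq_sym (negbTE xs) mulr0 scale0r.
Qed.

Let u_L1 : bochner_L1 (iterate_sigma a) S u.
Proof.
split; first by exists (fun=> u); split => // x _; exact: cvg_cst.
have mS := compact_borel hS.
apply: (@le_lt_trans _ _ (\int[iterate_sigma a]_(x in S) cst 1%E x)%E).
  by apply: ge0_le_lower_integral => // s _; rewrite lee_fin.
by rewrite integral_cst// mul1e iterate_sigmaE// ltry.
Qed.

Let u_integral : has_bochner_integral (iterate_sigma a) S u (iterate_v a).
Proof.
exists (fun=> u); split => //.
  rewrite [X in X @ _](_ : _ = cst 0%E); first exact: cvg_cst.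
  apply/funext => n; apply: integral0_eq => x _.
  by rewrite subrr normr0.
by rewrite simple_integral_u; exact: cvg_cst.
Qed.

(** The density [u] competes in the infimal convolution. Only an inequality holds in general:
    merging the atoms over one point of [S] can lower the cost, by subadditivity of [J]. *)
Lemma iterate_value :
  (tikhonov S J A f alpha (iterate_v a, iterate_sigma a) <= (objective a)%:E)%E.
Proof.
have mS := compact_borel hS.
rewrite /tikhonov /objective EFinD /= leeD2l//.
have -> : cost a = alpha * \sum_(q <- a) q.2 * fine (J q.1.1 q.1.2).
  by rewrite mulr_sumr; apply: eq_bigr => q _; rewrite mulrCA.
rewrite EFinM lee_pmul2l//.
apply: (@le_trans _ _ (\int[iterate_sigma a]_(s in S) J (u s) s)%E).
  by apply: ereal_inf_lbound; exists u.
(* On [S] this is the integrand, since [u] vanishes off the support and [J 0 s = 0]; its finite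
   support makes it measurable on the whole space. *)
pose k (s : E) : \bar R := if s \in supp then J (u s) s else 0%E.
have k0 s : (0 <= k s)%E.
  by rewrite /k; case: ifP => // ss; apply: hJ; exact: suppS.
have mk : measurable_fun (S : set (borelType E)) (k : borelType E -> \bar R).
  apply: measurable_funTS.
  apply: (@measurable_fun_finite_support _ _ _ supp 0%E) => // s ss.
  by rewrite /k (negbTE ss).
rewrite (eq_integral (k : borelType E -> \bar R)); last first.
  move=> s /set_mem Ss; rewrite /k; case: ifPn => // ss.
  by rewrite /u (negbTE ss) J0.
rewrite ge0_integral_measure_sum//.
apply: (@le_trans _ _ (\sum_(s <- supp) J (w s) s)%E).
  rewrite (big_nth 0) big_mkord; apply: lee_sum => i _.
  rewrite ge0_integral_mscale// integral_dirac//.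
  set s := nth 0 supp i; have ss : s \in supp by rewrite mem_nth.
  rewrite diracE mem_set ?mul1e; last exact: suppS.
  by rewrite /k ss -J_scale ?wu//; exact: suppS.
apply: (@le_trans _ _ (\sum_(s <- supp) \sum_(q <- a | q.1.2 == s) q.2%:E * J q.1.1 q.1.2)%E).
  rewrite big_seq [leRHS]big_seq; apply: lee_sum => s ss.
  rewrite /w -big_filter; apply: le_trans (J_sum _ (suppS ss) _) _.
    by move=> q; rewrite mem_filter => /andP[_ /aK[_ /ltW]].
  rewrite big_filter; rewrite le_eqVlt; apply/orP; left; apply/eqP.
  by apply: eq_bigr => q /eqP ->.
rewrite sum_supp -sumEFin big_seq [leRHS]big_seq; apply: lee_sum => q /aK[Kq _].
by rewrite EFinM fineK// atom_fin.
Qed.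

End iterate_measure.

(** * Existence of a minimizer *)

(** Take the point [a.1] of the ball over [s] whose first [n] moments are nearest to [rho]. If they
    differ, their difference is a direction that strictly separates [rho] from all moment vectors,
    and a rational approximation of it violates the hypothesis. *)
Lemma moment_point_fin (s : E) (rho : nat -> R) (n : nat) : S s ->
  (forall (c : seq rat) (r : rat), ratr r < combination c rho ->
     exists2 y, atoms (y, s) & ratr r <= combination c (fun i => pr (P i) y)) ->
  exists2 x, atoms (x, s) & forall i, (i < n)%N -> pr (P i) x = rho i.
Proof.
move=> Ss hrho; have [C C0 KC] := atoms_bounded.
pose phi x := \sum_(i < n) (rho i - pr (P i) x) ^+ 2.
have phi0 x : 0 <= phi x by apply: sumr_ge0 => i _; exact: sqr_ge0.
pose V := [set phi x | x in [set x | atoms (x, s)]].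
have V0 : has_inf V.
  split; first by exists (phi 0), 0 => //; exact: atom0.
  by exists 0 => _ [x _ <-].
have /choice[q qP] (k : nat) : exists x, atoms (x, s) /\ phi x < inf V + k.+1%:R^-1.
  have k0 : 0 < k.+1%:R^-1 :> R by rewrite invr_gt0.
  by have [_ [x Kx <-] xV] := inf_adherent k0 V0; exists x.
have [h [a [hk Ka qa qs]]] := @atoms_seq_compact (fun k => (q k, s)) (fun k => (qP k).1).
have as_ : a.2 = s by apply: (cvg_unique _ qs) => //; exact: cvg_cst.
have Kas : atoms (a.1, s) by rewrite -as_ -surjective_pairing.
have phia : phi a.1 <= inf V.
  have cphi : phi (q (h k)) @[k --> \oo] --> phi a.1.
    apply: cvg_big => [|i _]; first exact: add_continuous.
    rewrite expr2.
    by apply: cvgM; (apply: cvgB; [exact: cvg_cst|exact: (qa (P i))]).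
  apply/ler_addgt0Pr => e e0; rewrite -(cvg_lim _ cphi)//.
  apply: limr_le; first exact: cvgP cphi.
  near=> k; apply: (le_trans (ltW (qP (h k)).2)); rewrite lerD2l.
  apply: (@le_trans _ _ k.+1%:R^-1); first by rewrite lef_pV2 ?posrE// ler_nat ltnS.
  by apply: ltW; near: k; exact: (near_infty_natSinv_lt (PosNum e0)).
pose x i := rho i - pr (P i) a.1.
(* first-order optimality of the nearest point *)
have opt y : atoms (y, s) -> \sum_(i < n) x i * (pr (P i) y - pr (P i) a.1) <= 0.
  move=> Ky; rewrite -oppr_ge0 -(pmulr_rge0 _ (ltr0n R 2)).
  apply: (@le0_of_quadratic _ _ (\sum_(i < n) (pr (P i) y - pr (P i) a.1) ^+ 2)) => t /andP[t0 t1].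
  have Kt : atoms (t *: y + (1 - t) *: a.1, s).
    split => //=; apply: sublevel_ball_convex => //; last exact: Kas.2.
    - by rewrite ltW.
    - exact: Ky.2.
  have : phi a.1 <= phi (t *: y + (1 - t) *: a.1).
    apply: (le_trans phia); apply: ge_inf; first exact: V0.2.
    by exists (t *: y + (1 - t) *: a.1).
  rewrite -subr_ge0 /phi -sumrB !mulr_sumr -sumrN -?mulr_sumr.
  move=> hle; apply: (le_trans hle); rewrite le_eqVlt; apply/orP; left; apply/eqP.
  rewrite !mulr_sumr -big_split; apply: eq_bigr => i _ /=.
  rewrite linearDr/= [pr _ (t *: _)]linearZr_LR [pr _ ((1 - t) *: _)]linearZr_LR /x/=.
  by move: (rho i) (pr (P i) y) (pr (P i) a.1) => b b' b''; ring.
have xz : phi a.1 = 0.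
  apply/eqP; rewrite eq_le phi0 andbT leNgt; apply/negP => pos.
  (* [B] bounds all numbers paired with the direction, and [e] makes each rounding cost at most a
     quarter of the gap [phi a.1]. Two roundings and the choice of [r] spend three quarters of
     it. *)
  pose B := C + \sum_(i < n) `|rho i|.
  have B0 : 0 < B by rewrite ltr_wpDr// sumr_ge0.
  pose e := phi a.1 / (4 * (n%:R + 1) * B).
  have n0 : 0 < n%:R + 1 :> R by rewrite ltr_wpDl.
  have e0 : 0 < e by rewrite divr_gt0// !mulr_gt0.
  have [c [cn cx]] := rat_approx x n e0.
  have comb_near z : (forall i, (i < n)%N -> `|z i| <= B) ->
      `|combination c z - \sum_(i < n) x i * z i| <= phi a.1 / 4.
    move=> zB; rewrite /combination cn -sumrB.
    apply: (le_trans (ler_norm_sum _ _ _)).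
    apply: (@le_trans _ _ (\sum_(i < n) e * B)).
      apply: ler_sum => i _; rewrite -mulrBl normrM ler_pM//; last exact: zB.
      exact/ltW/cx.
    rewrite sumr_const card_ord -[(e * B) *+ n]mulr_natl /e.
    rewrite [leLHS](_ : _ = phi a.1 / 4 * (n%:R / (n%:R + 1))); last first.
      by field; rewrite !gt_eqF.
    by rewrite ler_piMr ?divr_ge0 ?(ltW pos)// ler_pdivrMr// mul1r lerDl.
  have rhoB i : (i < n)%N -> `|rho i| <= B.
    move=> ni; rewrite /B (bigD1 (Ordinal ni))//= addrCA lerDl addr_ge0 ?(ltW C0)//.
    exact: sumr_ge0.
  have pB y i : atoms (y, s) -> `|pr (P i) y| <= B.
    move=> /KC/= yC; rewrite (le_trans (pairing_le hpr _ _))//.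
    rewrite (@le_trans _ _ (1 * C))// ?ler_pM// ?hP.1// mul1r /B lerDl.
    exact: sumr_ge0.
  have h1 := comb_near rho rhoB.
  have [r] : exists r, ratr r \in
      `](combination c rho - phi a.1 / 4), (combination c rho)[.
    by apply: rat_in_itvoo; rewrite ltrBlDr ltrDl divr_gt0.
  rewrite in_itv/= => /andP[r1 /hrho[y Ky yr]].
  have h2 := comb_near (fun i => pr (P i) y) (fun i _ => pB y i Ky).
  have h3 := opt y Ky.
  have h4 : \sum_(i < n) x i * rho i - \sum_(i < n) x i * pr (P i) a.1 = phi a.1.
    by rewrite -sumrB; apply: eq_bigr => i _; rewrite -mulrBr expr2.
  have h5 : \sum_(i < n) x i * (pr (P i) y - pr (P i) a.1) =
      \sum_(i < n) x i * pr (P i) y - \sum_(i < n) x i * pr (P i) a.1.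
    by rewrite -sumrB; apply: eq_bigr => i _; rewrite mulrBr.
  rewrite h5 in h3; move: h1 h2; rewrite !ler_norml => /andP[h1 h1'] /andP[h2 h2'].
  by move: pos; lra.
exists a.1 => // i ni; apply/eqP; rewrite eq_sym -subr_eq0 -sqrf_eq0.
move/eqP: xz; rewrite psumr_eq0; last by move=> j _; exact: sqr_ge0.
by move=> /allP/(_ (Ordinal ni)); rewrite mem_index_enum => /(_ isT).
Unshelve. all: by end_near. Qed.

(** In a limit of the finite solutions, each moment is eventually constant along the sequence. *)
Lemma moment_point (s : E) (rho : nat -> R) : S s ->
  (forall (c : seq rat) (r : rat), ratr r < combination c rho ->
     exists2 y, atoms (y, s) & ratr r <= combination c (fun i => pr (P i) y)) ->
  exists2 x, atoms (x, s) & forall i, pr (P i) x = rho i.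
Proof.
move=> Ss hrho.
have /choice[q qP] (n : nat) : exists x, atoms (x, s) /\ forall i, (i < n)%N -> pr (P i) x = rho i.
  by have [x] := moment_point_fin n Ss hrho; exists x.
have [h [a [hk Ka qa qs]]] := @atoms_seq_compact (fun k => (q k, s)) (fun k => (qP k).1).
have as_ : a.2 = s by apply: (cvg_unique _ qs) => //; exact: cvg_cst.
exists a.1 => [|i]; first by rewrite -as_ -surjective_pairing.
apply: (cvg_unique _ (qa (P i))) => //; apply: cvg_near_cst; near=> k.
rewrite /= (qP (h k)).2//; apply: (leq_trans _ (hk k)).
by near: k; exact: nbhs_infty_ge.
Unshelve. all: by end_near. Qed.

(** * The relaxed problem over finite combinations of atoms *)

Definition conic (a : state) := forall q, q \in a -> atoms q.1 /\ 0 <= q.2.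

(** Takes the place of [cost] by charging 1 for every atom, so that the ultralimit of the costs is
    simply [L (cst 1)]. *)
Definition weight_sum (a : state) : R := \sum_(q <- a) q.2.

Lemma ultra_functional (U : set_system nat) (mu : nat -> state) (G : R) :
  UltraFilter U -> (forall n, conic (mu n)) -> (forall n, weight_sum (mu n) <= G) ->
  exists2 L, positive_functional atoms L & forall phi, bounded_on atoms phi ->
    \sum_(q <- mu n) q.2 * phi q.1 @[n --> U] --> L phi.
Proof.
move=> UU muK muG.
have /choice[L LP] phi : exists l : R, bounded_on atoms phi ->
    \sum_(q <- mu n) q.2 * phi q.1 @[n --> U] --> l.
  have [[M phiM]|nb] := pselect (bounded_on atoms phi); last by exists 0.
  have [|l _ hl] := @bounded_ultra_cvg _ _ U
    (fun n => \sum_(q <- mu n) q.2 * phi q.1) (G * `|M|) UU; last by exists l.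
  move=> n; apply: (le_trans (ler_norm_sum _ _ _)).
  apply: (@le_trans _ _ (\sum_(q <- mu n) q.2 * `|M|)); last first.
    by rewrite -mulr_suml ler_wpM2r// muG.
  rewrite big_seq [leRHS]big_seq; apply: ler_sum => q qn.
  have [Kq q0] := muK n q qn; rewrite normrM ger0_norm// ler_wpM2l//.
  by rewrite (le_trans (phiM _ Kq))// ler_norm.
have bD (phi psi : X * E -> R) : bounded_on atoms phi -> bounded_on atoms psi ->
    bounded_on atoms (phi \+ psi).
  move=> [M phiM] [N psiN]; exists (M + N) => z Kz /=.
  by rewrite (le_trans (ler_normD _ _))// lerD// ?phiM ?psiN.
exists L => //; split.
- move=> phi psi bphi bpsi.
  have h := LP _ (bD _ _ bphi bpsi); apply: (cvg_unique _ h) => //.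
  rewrite [X in X @ _](_ : _ = fun n => \sum_(q <- mu n) q.2 * phi q.1 +
      \sum_(q <- mu n) q.2 * psi q.1).
    by apply: cvgD; exact: LP.
  apply/funext => n; rewrite -big_split; apply: eq_bigr => q _ /=.
  by rewrite mulrDr.
- move=> c phi bphi; have h := LP _ (bounded_onZ c bphi).
  apply: (cvg_unique _ h) => //.
  rewrite [X in X @ _](_ : _ = fun n => c * \sum_(q <- mu n) q.2 * phi q.1).
    by apply: cvgMl_tmp; exact: LP.
  apply/funext => n; rewrite mulr_sumr; apply: eq_bigr => q _ /=.
  by rewrite mulrCA.
- move=> phi psi bphi bpsi le_phi_psi.
  apply: (ler_cvg_to (LP _ bphi) (LP _ bpsi)); apply: nearW => n.
  rewrite big_seq [leRHS]big_seq; apply: ler_sum => q qn.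
  by have [Kq q0] := muK n q qn; rewrite ler_wpM2l// le_phi_psi.
Qed.

Lemma norm_iterate_conic C a : (forall y, atoms y -> `|y.1| <= C) -> conic a ->
  `|iterate_v a| <= C * weight_sum a.
Proof.
move=> KC aK; rewrite /iterate_v /weight_sum mulr_sumr.
apply: (le_trans (ler_norm_sum _ _ _)); rewrite big_seq [leRHS]big_seq.
apply: ler_sum => q /aK[Kq q0]; rewrite normrZ ger0_norm// mulrC.
by rewrite ler_wpM2r// KC.
Qed.

Lemma conic_mix a (q : X * E) t T : conic a -> atoms q -> 0 <= t <= 1 -> 0 <= T ->
  exists2 c, conic c & misfit (iterate_v c) + weight_sum c =
    misfit (iterate_v a + t *: (T *: q.1 - iterate_v a)) +
      (weight_sum a + t * (T - weight_sum a)).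
Proof.
move=> aK Kq /andP[t0 t1] T0; exists (rcons (rescale (1 - t) a) (q, t * T)).
  move=> w; rewrite mem_rcons inE => /predU1P[->|/mapP[r ra ->]] /=.
    by rewrite mulr_ge0.
  by have [Kr r0] := aK r ra; rewrite mulr_ge0// subr_ge0.
rewrite iterate_v_rcons iterate_v_rescale/=.
have -> : (1 - t) *: iterate_v a + (t * T) *: q.1 =
    iterate_v a + t *: (T *: q.1 - iterate_v a).
  by rewrite scalerBl scale1r scalerBr scalerA -addrA [- _ + _]addrC.
congr (_ + _); rewrite /weight_sum -cats1 big_cat big_seq1/= big_map/=.
by rewrite -mulr_sumr; ring.
Qed.

Let val (a : state) : R := misfit (iterate_v a) + weight_sum a.

(** No duality gap: if [v] did better than the infimum [m], a conditional gradient step from a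
    nearly optimal combination would fall below [m]. *)
Lemma relaxed_lower (m : R) :
  (forall a, conic a -> m <= val a) ->
  (forall e, 0 < e -> exists2 a, conic a & val a < m + e) ->
  forall v gam, 0 <= gam -> dominated v gam -> m <= misfit v + gam.
Proof.
move=> mle minf v gam gam0 vgam; rewrite leNgt; apply/negP => vm.
have nil0 : val [::] = misfit 0.
  by rewrite /val /iterate_v /weight_sum !big_nil addr0.
have gamT : gam <= misfit 0.
  rewrite leNgt; apply/negP => gT.
  have := mle [::]; rewrite nil0 => /(_ _); have := misfit_ge0 v.
  by move=> h1 h2; have := h2 (fun q => ltac:(by [])); lra.
have [L L0 AL] := operator_bounded; have [C C0 KC] := atoms_bounded.
have m0 : 0 <= m.
  by rewrite (le_trans _ (ltW vm))// addr_ge0// misfit_ge0.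
have [D DE] : exists D, D = (L * (C * misfit 0 + C * (m + 1))) ^+ 2 by eexists.
have : 0 <= - (m - (misfit v + gam)).
  apply: (@le0_of_quadratic _ _ (2^-1 * D)) => t /andP[t0 t1].
  (* The step [t] is fixed while the defect [e] tends to 0; only afterwards does [t] tend to 0. *)
  apply/ler_addgt0Pr => e e0.
  (* The cap at 1 bounds the weights independently of [e], so one [D] serves all approximations. *)
  have e1 : 0 < Num.min e 1 by rewrite lt_min e0/=.
  have [a aK ae] := minf _ e1.
  have ae' : val a < m + e by rewrite (lt_le_trans ae)// lerD2l ge_min lexx.
  have a1 : val a < m + 1 by rewrite (lt_le_trans ae)// lerD2l ge_min lexx orbT.
  have [q qc qmax] := argmax_extreme (dual_certificate (iterate_v a)) hS0.
  have Kq := candidates_atoms qc.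
  pose T := if 1 <= pr (dual_certificate (iterate_v a)) q.1 then misfit 0 else 0.
  have /andP[T0 T1] : 0 <= T <= misfit 0.
    by rewrite /T; case: ifP => _; rewrite ?lexx misfit_ge0.
  have t01 : 0 <= t <= 1 by rewrite ltW.
  have gT : 0 <= gam <= misfit 0 by rewrite gam0.
  have [c cK cE] := conic_mix aK Kq t01 T0.
  have pv := vgam _ _ (argmax_ge0 qmax) qmax.
  have stp := conditional_gradient_step (weight_sum a) gT (ltW t0) pv (erefl T).
  have wa : weight_sum a <= m + 1.
    by rewrite (le_trans _ (ltW a1))// lerDr misfit_ge0.
  have bound : `|A (T *: q.1 - iterate_v a)| ^+ 2 <= D.
    have C0' := ltW C0; rewrite DE ler_pXn2r ?nnegrE//; last first.
      by rewrite mulr_ge0 ?(ltW L0)// addr_ge0// mulr_ge0 ?misfit_ge0// addr_ge0.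
    rewrite (le_trans (AL _))// ler_pM2l// (le_trans (ler_normB _ _))// lerD//.
      by rewrite normrZ ger0_norm// mulrC ler_pM// KC.
    by rewrite (le_trans (norm_iterate_conic KC aK))// ler_pM2l.
  have t2 : 0 <= t ^+ 2 / 2 by rewrite mulr_ge0 ?exprn_ge0 ?(ltW t0)// invr_ge0.
  have := ler_wpM2l t2 bound; have := mle c cK; rewrite /val cE; move: stp.
  have : t * (m - (misfit v + gam)) <= t * (val a - (misfit v + gam)).
    by rewrite ler_pM2l// lerD2r mle.
  rewrite /val in ae' *.
  rewrite (_ : t ^+ 2 * (2^-1 * D) = t ^+ 2 / 2 * D); last by ring.
  move: (t ^+ 2 / 2 * D) (t ^+ 2 / 2 * _) => w1 w2.
  lra.
lra.
Qed.

Lemma relaxed_minimizer : exists v (g : R) L,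
  [/\ positive_functional atoms L, L (cst 1) = g,
     forall i, L (fun z => pr (P i) z.1) = pr (P i) v &
     forall v' gam, 0 <= gam -> dominated v' gam -> misfit v + g <= misfit v' + gam].
Proof.
have conic_nil : conic [::] by [].
have weight_ge0 a : conic a -> 0 <= weight_sum a.
  by move=> aK; rewrite /weight_sum big_seq; apply: sumr_ge0 => q /aK[].
have val_ge0 a : conic a -> 0 <= val a.
  by move=> aK; rewrite addr_ge0 ?misfit_ge0// weight_ge0.
pose V := [set val a | a in conic].
have V0 : has_inf V.
  split; first by exists (val [::]), [::].
  by exists 0 => _ [a aK <-]; exact: val_ge0.
have mle a : conic a -> inf V <= val a.
  by move=> aK; apply: ge_inf; [exact: V0.2|exists a].
have minf e : 0 < e -> exists2 a, conic a & val a < inf V + e.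
  by move=> e0; have [_ [a aK <-] ae] := inf_adherent e0 V0; exists a.
have /choice[mu muP] (n : nat) : exists a, conic a /\ val a < inf V + n.+1%:R^-1.
  have n0 : 0 < n.+1%:R^-1 :> R by rewrite invr_gt0.
  by have [a] := minf _ n0; exists a.
have [U [UU ooU]] := ultraFilterLemma eventually_filter.
have muG n : weight_sum (mu n) <= inf V + 1.
  have [_ muV] := muP n; apply: (@le_trans _ _ (val (mu n))).
    by rewrite lerDr misfit_ge0.
  by rewrite (le_trans (ltW muV))// lerD2l invf_le1// ler1n.
have [L hL Lmu] := ultra_functional UU (fun n => (muP n).1) muG.
have [C C0 KC] := atoms_bounded.
have xC n : `|iterate_v (mu n)| <= C * (inf V + 1).
  by rewrite (le_trans (norm_iterate_conic KC (muP n).1))// ler_pM2l.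
have [v xv] := banach_alaoglu_ultra hpr UU xC.
have pair_sum p a : pr p (iterate_v a) = \sum_(q <- a) q.2 * pr p q.1.1.
  by rewrite /iterate_v linear_sum/=; apply: eq_bigr => q _; rewrite linearZr_LR.
have bpair p : bounded_on atoms (fun z => pr p z.1).
  exists (`|p| * C) => z Kz; rewrite (le_trans (pairing_le hpr _ _))//.
  by rewrite ler_wpM2l// KC.
have b1 : bounded_on atoms (cst (1 : R)) by exists 1 => z _; rewrite normr1.
exists v, (L (cst 1)), L; split => //.
  move=> i; have h := Lmu _ (bpair (P i)); apply: (cvg_unique _ h) => //.
  rewrite [X in X @ _](_ : _ = fun n => pr (P i) (iterate_v (mu n))); first exact: xv.
  by apply/funext => n; rewrite pair_sum.
suff vle : misfit v + L (cst 1) <= inf V.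
  move=> v' gam gam0 vgam; apply: (le_trans vle).
  exact: relaxed_lower mle minf _ _ gam0 vgam.
(* Lower semicontinuity of [misfit] along the ultrafilter: its tangent at the limit [v] involves
   only the convergent pairing with [p]. *)
pose p := dual_certificate v.
have gcvg : weight_sum (mu n) @[n --> U] --> L (cst 1).
  have h := Lmu _ b1; rewrite [X in X @ _](_ : _ = fun n => \sum_(q <- mu n) q.2 * cst 1 q.1)//.
  by apply/funext => n; apply: eq_bigr => q _; rewrite mulr1.
have lhs : misfit v + pr p v - pr p (iterate_v (mu n)) + weight_sum (mu n) @[n --> U]
    --> misfit v + pr p v - pr p v + L (cst 1).
  apply: cvgD; last exact: gcvg.
  by apply: cvgB; [exact: cvg_cst|exact: xv].
have rhs : inf V + n.+1%:R^-1 @[n --> U] --> inf V + 0.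
  apply: cvgD; first exact: cvg_cst.
  apply: cvg_trans (@cvg_harmonic R); exact: cvg_app ooU.
have := ler_cvg_to lhs rhs; rewrite addrK addr0; apply.
apply: nearW => n; apply: (le_trans _ (ltW (muP n).2)); rewrite /val lerD2r.
exact: misfit_lower.
Qed.

Definition coordinate (i : nat + 'I_d) (z : X * E) : R :=
  match i with inl k => pr (P k) z.1 | inr j => z.2 ord0 j end.

Lemma coordinate_bounded i : bounded_on atoms (coordinate i).
Proof.
case: i => [k|j].
  have [C C0 KC] := atoms_bounded; exists C => z Kz /=.
  rewrite (le_trans (pairing_le hpr _ _))// -[leRHS]mul1r ler_pM ?hP.1//.
  exact: KC.
have cc : compact [set s ord0 j | s in S].
  apply: continuous_compact => //; apply: continuous_subspaceT.
  exact: coord_continuous.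
have [M [_ MP]] := compact_bounded cc; exists (M + 1) => z [Sz _] /=.
by apply: MP; [rewrite ltrDl|exists z.2].
Qed.

Lemma coordinate_compact (z : nat -> X * E) : (forall n, atoms (z n)) ->
  exists (h : nat -> nat) (a : X * E), [/\ forall k, (k <= h k)%N, atoms a &
    forall i, coordinate i (z (h k)) @[k --> \oo] --> coordinate i a].
Proof.
move=> Kz; have [h [a [hk Ka za zs]]] := atoms_seq_compact Kz.
exists h, a; split => // -[k|j] /=; first exact: (za (P k)).
apply: (@cvg_comp _ _ _ (fun k => (z (h k)).2) (fun s : E => s ord0 j) _ _ _ zs).
exact: coord_continuous.
Qed.

(** A projection along a sequentially compact set; it makes the exceptional sets in the realization
    Borel. *)
Lemma superlevel_closed (p : Xs) (r : R) :
  closed [set s | exists2 y, atoms (y, s) & r <= pr p y].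
Proof.
move=> s sc.
have /choice[q qP] (n : nat) : exists q : X * E,
    [/\ atoms q, r <= pr p q.1 & ball s n.+1%:R^-1 q.2].
  have n0 : 0 < n.+1%:R^-1 :> R by rewrite invr_gt0.
  have [s' [[y Ky ry] ss']] := sc _ (nbhsx_ballx s _ n0).
  by exists (y, s').
have [h [a [hk Ka qa qs]]] := atoms_seq_compact (fun n => let: And3 Kq _ _ := qP n in Kq).
have as_ : a.2 = s.
  apply: (cvg_unique _ qs) => //; apply/cvg_ballP => e e0; near=> k.
  have [_ _] := qP (h k); apply: le_ball; apply: (@le_trans _ _ k.+1%:R^-1).
    by rewrite lef_pV2 ?posrE// ler_nat ltnS.
  by apply: ltW; near: k; exact: (near_infty_natSinv_lt (PosNum e0)).
exists a.1; first by rewrite -as_ -surjective_pairing.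
by apply: (cvg_ge_const (qa p)) => n; have [] := qP (h n).
Unshelve. all: by end_near. Qed.

Definition rational_form (c : seq rat) : Xs := \sum_(i < size c) ratr (nth 0 c i) *: P i.

Lemma pairing_rational_form c y :
  pr (rational_form c) y = combination c (fun i => pr (P i) y).
Proof.
rewrite /rational_form (big_morph (pr ^~ y) (fun p q => linearDl pr y p q) (linear0l pr y)).
by apply: eq_bigr => i _; rewrite linearZl_LR.
Qed.

(** * Disintegration of the functional over the compact set *)

Section realization.
Context (L : (X * E -> R) -> R) (hL : positive_functional atoms L) (v : X).
Hypothesis Lv : forall i, L (fun z => pr (P i) z.1) = pr (P i) v.
Hypothesis hX : separable X.

Let D : set R := cell_itv L (@root R (X * E)%type).

Let mD : measurable D.
Proof. exact: measurable_itv. Qed.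

Let lebD : (lebesgue_measure D = (L (cst 1))%:E)%E.
Proof.
rewrite /D (cell_itv_measure hL) /mass/=; congr (L _)%:E.
by apply/funext => z; rewrite indicT.
Qed.

Lemma realization : exists2 sigma : measE, radon_plus S sigma &
  (infconv S J v sigma <= (alpha^-1 * L (cst 1))%:E)%E.
Proof.
have [s0 Ss0] := hS0; have mS := compact_borel hS.
pose W (n : nat) : set (X * E) :=
  if (unpickle n : option ((nat + 'I_d) * rat)) is Some (i, r)
  then [set z | ratr r <= coordinate i z] else set0.
have [G [KG Gint]] := representation hL (atom0 Ss0) coordinate_bounded
  coordinate_compact (fun n => erefl (W n)).
(* The default [s0] off the interval keeps the curve in [S] for every parameter. *)
pose gam t : E := if t \in D then (G t).2 else s0.
have Sgam t : S (gam t) by rewrite /gam; case: ifP => // _; have [] := KG t.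
have mgam : measurable_fun setT (gam : R -> borelType E).
  apply: measurable_fun_rV => j.
  rewrite (_ : (fun t => _) = fun t => if t \in D then (G t).2 ord0 j else s0 ord0 j).
    by apply: measurable_fun_patch => //; have [] := Gint (inr j).
  by apply/funext => t; rewrite /gam; case: ifP.
have mpre (B : set (borelType E)) : measurable B -> measurable (gam @^-1` B).
  by move=> mB; rewrite -[X in measurable X]setTI; exact: mgam.
have [sigma sigmaE] := image_measure (mrestr lebesgue_measure mD) mgam.
have sE B : sigma B = lebesgue_measure (gam @^-1` B `&` D) by rewrite sigmaE.
have sT : sigma setT = (L (cst 1))%:E by rewrite sE preimage_setT setTI lebD.
have sfin : (sigma setT < +oo)%E by rewrite sT ltry.
have sS : sigma (~` S) = 0%E.
  rewrite sE (_ : _ `&` D = set0) ?measure0//.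
  by apply/seteqP; split => // t [/= nS _]; exact: nS (Sgam t).
have sSle : (sigma S <= (L (cst 1))%:E)%E.
  by rewrite -sT; apply: le_measure; rewrite ?inE.
have sSoo : (sigma S < +oo)%E by rewrite (le_lt_trans sSle)// ltry.
exists sigma; first exact: radon_plus_finite.
have Doo : (lebesgue_measure D < +oo)%E by rewrite lebD ltry.
pose fi i t := pr (P i) (G t).1.
have mfi i : measurable_fun D (fi i) by have [] := Gint (inl i).
have ifi i : lebesgue_measure.-integrable D (EFin \o fi i).
  apply: measurable_bounded_integrable => //; first exact: mfi.
  have [M MP] := coordinate_bounded (inl i).
  exists M; split; first exact: num_real.
  by move=> y My t Dt /=; rewrite (le_trans _ (ltW My))//; exact: MP (KG t).
pose w i t := if t \in D then fi i t else 0.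
have wE i : EFin \o w i = (EFin \o fi i) \_ D.
  by apply/funext => t; rewrite /= /w patchE; case: ifP.
have wint i (B : set R) : (\int[lebesgue_measure]_(t in B) (w i t)%:E =
    \int[lebesgue_measure]_(t in B `&` D) (fi i t)%:E)%E.
  rewrite integral_mkcondr; apply: eq_integral => t _.
  by have /(congr1 (fun z => z t)) := wE i.
have /choice[rho rhoP] (i : nat) : exists rho : borelType E -> R,
    sigma.-integrable setT (EFin \o rho) /\ forall B, measurable B ->
    (\int[sigma]_(s in B) (rho s)%:E =
     \int[lebesgue_measure]_(t in gam @^-1` B `&` D) (fi i t)%:E)%E.
  have [|B mB sB0|rho [irho rhoE]] :=
      @conditional_density _ _ _ _ _ lebesgue_measure _ mgam sigma (w i) sfin.
  - have mD' : measurable (D : set (measurableTypeR R)) by exact: mD.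
    have h := (integrable_mkcond _ mD').1 (ifi i).
    by rewrite -wE in h; exact: h.
  - rewrite wint; apply: null_set_integral; last by move: sB0; rewrite sE; apply.
      by apply: measurableI => //; exact: mpre.
    by apply/measurable_EFinP; apply: measurable_funS (mfi i) => //; exact: subIsetr.
  - by exists rho; split => // B mB; rewrite rhoE// wint.
have mrho i : measurable_fun setT (rho i).
  by apply/measurable_EFinP; exact: measurable_int (rhoP i).1.
have mcomb c : measurable_fun setT (fun s => combination c (rho ^~ s)).
  apply: measurable_sum => i; apply: measurable_funM => //.
pose H c (r : rat) := [set s : E | exists2 y, atoms (y, s) & ratr r <= pr (rational_form c) y].
(* Points where the densities violate a linear inequality valid for all atoms over [s]. On the
   preimage of [N c r] the curve consists of atoms over such points, so their pairings stay below
   [r]; the integral of the positive excess is then nonpositive, and the set is null. *)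
pose N c (r : rat) := [set s : borelType E | ratr r < combination c (rho ^~ s)] `&` ~` H c r.
have mN c r : measurable (N c r).
  apply: measurableI; last first.
    by apply: measurableC; apply: closed_borel; exact: superlevel_closed.
  have mt : measurable [set true] by [].
  rewrite -[X in measurable X]setTI.
  exact: (measurable_fun_ltr (measurable_cst (ratr r : R)) (mcomb c) measurableT mt).
have N0 c r : sigma (N c r) = 0%E.
  apply: (@positive_integral_null _ _ _ _ _ (fun s => combination c (rho ^~ s) - ratr r)) => //.
  - by apply: measurable_funB; [exact: measurable_funTS|exact: measurable_cst].
  - by move=> s [/= rs _]; rewrite subr_gt0.
  have mA : measurable (gam @^-1` N c r `&` D : set (measurableTypeR R)).
    by apply: measurableI => //; exact: mpre.
  have irho i : sigma.-integrable (N c r) (EFin \o rho i).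
    exact: integrableS (rhoP i).1.
  have ifA i : lebesgue_measure.-integrable (gam @^-1` N c r `&` D) (EFin \o fi i).
    by apply: integrableS (ifi i) => //; exact: subIsetr.
  have [irc rcE] := integral_combination c (mN c r) irho.
  have [ifc fcE] := integral_combination c mA ifA.
  have icst : sigma.-integrable (N c r) (EFin \o cst (ratr r : R)).
    apply: measurable_bounded_integrable => //; last exact: bounded_cst.
    by apply: le_lt_trans sfin; apply: le_measure; rewrite ?inE.
  under eq_integral do rewrite EFinB.
  rewrite (integralB_EFin (mN c r) irc icst) rcE.
  rewrite (eq_bigr (fun i : 'I_(size c) => (ratr (nth 0%R c i))%:E *
    \int[lebesgue_measure]_(t in gam @^-1` N c r `&` D) (fi i t)%:E)%E); last first.
    by move=> i _; rewrite (rhoP i).2.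
  rewrite -fcE.
  have -> : (\int[sigma]_(s in N c r) (cst (ratr r : R) s)%:E =
      \int[lebesgue_measure]_(t in gam @^-1` N c r `&` D) (cst (ratr r : R) t)%:E)%E.
    have cE := integral_cst lebesgue_measure mA (ratr r : R)%:E.
    have := integral_cst sigma (mN c r) (ratr r : R)%:E.
    by rewrite /= in cE *; move=> ->; rewrite cE; congr (_ * _)%E; exact: sE.
  have icst' : lebesgue_measure.-integrable (gam @^-1` N c r `&` D) (EFin \o cst (ratr r : R)).
    apply: measurable_bounded_integrable => //; last exact: bounded_cst.
    apply: le_lt_trans Doo; apply: le_measure; rewrite ?inE//.
  rewrite leeBlDr; last exact: (integrable_fin_num mA icst').
  rewrite add0e; apply: le_integral => // t /set_mem[[_ /= nH] Dt].
  rewrite lee_fin leNgt; apply/negP => rt; apply: nH.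
  exists (G t).1; last by rewrite pairing_rational_form ltW.
  by rewrite /gam (mem_set Dt) -surjective_pairing.
pose Nn n : set (borelType E) :=
  if (unpickle n : option (seq rat * rat)) is Some (c, r) then N c r else set0.
have mNn n : measurable (Nn n) by rewrite /Nn; case: unpickle => [[c r]|].
pose Bad := \bigcup_n Nn n.
have mBad : measurable Bad by exact: bigcup_measurable.
have Bad0 : sigma Bad = 0%E.
  apply/eqP; rewrite -measure_le0.
  apply: (le_trans (measure_sigma_subadditive sigma mNn mBad (@subset_refl _ _))).
  rewrite eseries0// => n _ _; rewrite /Nn.
  by case: unpickle => [[c r]|]; [exact: N0|rewrite measure0].
pose Good : set (borelType E) := S `\` Bad.
have mGood : measurable Good by exact: measurableD.
have /choice[u uP] (s : E) : exists x, if s \in Good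
    then atoms (x, s) /\ (forall i, pr (P i) x = rho i s) else x = 0.
  case: (boolP (s \in Good)) => [Gs|_]; last by exists 0.
  have [Ss nBad] : Good s by exact: set_mem Gs.
  have [|x Kx xrho] := @moment_point s (rho ^~ s) Ss; last by exists x.
  move=> c r rc; have [y Ky ry] : H c r s.
    apply: contrapT => nH; apply: nBad; exists (pickle (c, r)) => //.
    by rewrite /Nn pickleK.
  by exists y => //; rewrite -pairing_rational_form.
have puE i s : pr (P i) (u s) = if s \in Good then rho i s else 0.
  by have := uP s; case: (s \in Good) => [[_ ->]//|->]; rewrite linear0r.
have mu i : measurable_fun setT (fun s : borelType E => pr (P i) (u s)).
  rewrite (_ : (fun s => _) = fun s => if s \in Good then rho i s else 0).
    by apply: measurable_fun_patch => //; exact: measurable_funTS.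
  by apply/funext => s; rewrite puE.
have [C C0 KC] := atoms_bounded.
have uC s : `|u s| <= C.
  by have := uP s; case: (s \in Good) => [[/KC]//|->]; rewrite normr0 ltW.
have uint i : (\int[sigma]_(s in S) (pr (P i) (u s))%:E = (pr (P i) v)%:E)%E.
  transitivity (\int[sigma]_(s in S) (rho i s)%:E)%E.
    apply: ae_eq_integral => //.
    - by apply/measurable_EFinP; exact: measurable_funTS.
    - by apply/measurable_EFinP; exact: measurable_funTS.
    - exists Bad; split => // s /= ns; apply: contrapT => nBad; apply: ns => Ss.
      by rewrite puE mem_set.
  rewrite (rhoP i).2// (_ : _ `&` D = D).
    by rewrite -Lv; have [_] := Gint (inl i).
  by apply/seteqP; split => [t []//|t Dt]; split => //; exact: Sgam.
have [uL uv] := bochner_of_norming hpr hP hX mS sSoo mu uC uint.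
apply: (@le_trans _ _ (\int[sigma]_(s in S) J (u s) s)%E).
  by apply: ereal_inf_lbound; exists u.
(* Each value of [u] is an atom or 0, so [J] is at most [alpha^-1], and [sigma] has mass at most
   [L (cst 1)] on [S]. *)
apply: (@le_trans _ _ (\int[sigma]_(s in S) (cst (alpha^-1)%:E) s)%E).
  apply: ge0_le_lower_integral => s Ss; first exact: hJ.
  have := uP s; case: (s \in Good) => [[[_ /sublevel_ballP//]]|->].
  by rewrite J0// lee_fin invr_ge0 ltW.
by rewrite integral_cst// EFinM lee_wpmul2l// lee_fin invr_ge0 ltW.
Qed.

End realization.

Theorem minimizer_and_rate : separable X ->
  let M := [set w : X * measE | radon_plus S w.2] in
  let F := tikhonov S J A f alpha in
  (forall k a, terminates_at pr A Astar S J alpha f k a ->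
     minimizer M F (iterate_v a, iterate_sigma a)) /\
  (exists2 C : R, 0 < C &
   exists2 wmin, minimizer M F wmin &
     forall k a, iterates k a ->
       (F (iterate_v a, iterate_sigma a) - F wmin <= (C / k.+1%:R)%:E)%E).
Proof.
move=> hX M F.
(* Every competitor of finite value is dominated with [gam] equal to its cost, so a bound over
   dominated points is a bound over all measures. *)
have Fle (w : X * measE) (m : R) : radon_plus S w.2 ->
    (forall gam, 0 <= gam -> dominated w.1 gam -> m <= misfit w.1 + gam) ->
    (m%:E <= F w)%E.
  move=> Mw mle; have [Foo|] := boolP (F w < +oo)%E; last first.
    by rewrite -leNgt leye_eq => /eqP ->; rewrite leey.
  have [gam gam0 [FE wgam]] := tikhonov_fin Mw Foo; rewrite /F FE.
  by rewrite lee_fin mle.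
split.
  move=> k a ter; have aK := iterates_atoms ter.1.
  split => /=; first exact: iterate_sigma_radon.
  move=> w Mw; apply: (le_trans (iterate_value aK)); apply: Fle => // gam gam0 wgam.
  exact: terminates_minimal ter gam0 wgam.
have [C C0 rate] := iterates_rate; exists C => //.
have [v [g [L [hL Lg Lv vmin]]]] := relaxed_minimizer.
have [sigma Ms Ile] := realization hL Lv hX.
have Fv : (F (v, sigma) <= (misfit v + g)%:E)%E.
  rewrite /F /tikhonov EFinD leeD2l//=.
  rewrite (_ : g = alpha * (alpha^-1 * L (cst 1))); last first.
    by rewrite Lg mulrA divff ?mul1r// gt_eqF.
  by rewrite EFinM lee_pmul2l.
have wmin : minimizer M F (v, sigma).
  split => // w Mw; apply: (le_trans Fv); apply: Fle => // gam gam0 wgam.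
  exact: vmin.
exists (v, sigma) => // k a it; have aK := iterates_atoms it.
have [gam gam0 [FE vgam]] := tikhonov_fin (w := (v, sigma)) Ms (le_lt_trans Fv (ltry _)).
rewrite -/F in FE; rewrite FE.
(* The rate covers competitors of cost at most [misfit 0]; comparing the minimizer with the zero
   point shows that it is one of them. *)
have gamT : 0 <= gam <= misfit 0.
  rewrite gam0/=; have d0 : dominated 0 0 by move=> p m _ _; rewrite linear0r mulr0.
  have := vmin 0 0 (lexx _) d0; rewrite addr0.
  have : misfit v + gam <= misfit v + g by rewrite -lee_fin -FE.
  have := misfit_ge0 v; lra.
rewrite leeBlDr//; apply: (le_trans (iterate_value aK)).
by rewrite -EFinD lee_fin -lerBlDr; exact: rate.
Qed.

End problem.

Theorem corollary5p8 (R : realType)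
    (Xs X Y : completeNormedModType R)
    (pr : {bilinear Xs -> X -> R | *%R & *%R}) (hpr : is_predual pr)
    (hX : separable X)
    (ip : {dot Y for idfun}) (hip : induces_norm ip) (hY : separable Y)
    (A : {linear X -> Y}) (Astar : {linear Y -> Xs})
    (hAstar : continuous Astar)
    (hA : forall (y : Y) (v : X), pr (Astar y) v = ip y (A v))
    (d : nat) (S : set 'rV[R]_d) (hS0 : S !=set0) (hS : compact S)
    (J : X -> 'rV[R]_d -> \bar R) (hJ : proper_borel S J)
    (alpha : R) (halpha : 0 < alpha)
    (H1 : hypothesis_H1 S J) (H2 : hypothesis_H2 S J pr)
    (H3 : hypothesis_H3 S J) (I1 : hypothesis_I1 S J pr A)
    (f : Y) :
  let M := [set w : X * {measure set (borelType 'rV[R]_d) -> \bar R}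
           | radon_plus S w.2] in
  let F := tikhonov S J A f alpha in
  (forall k a, terminates_at pr A Astar S J alpha f k a ->
     minimizer M F (iterate_v a, iterate_sigma a)) /\
  (exists2 C : R, 0 < C &
   exists2 wmin, minimizer M F wmin &
     forall k a, is_iterate pr A Astar S J alpha f k a ->
       (F (iterate_v a, iterate_sigma a) - F wmin <= (C / k.+1%:R)%:E)%E).
Proof.
have [P hP] := norming_seq_exists hpr hX; have [hJ0 _ _] := hJ.
exact: (minimizer_and_rate hpr hP hS hJ0 halpha H1 H2 H3 hip hAstar hA f hS0 hX).
Qed.
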